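(* Let $d\ge 1$ and let $(X_i, i\ge 1)$ be independent, identically distributed, centered, $\mathbb{R}^d$-valued random variables with finite, non-degenerate covariance matrix $\Sigma$, defined on a common probability space. For integers $n\ge 1$ let $S_n=X_1+\dots+X_n$, and let $\xi\sim\mathcal{N}(0,\Sigma)$ be a centered Gaussian vector in $\mathbb{R}^d$ with covariance matrix $\Sigma$. Then for every bounded, uniformly continuous $f:\mathbb{R}^d\to\mathbb{R}$, $$\mathbb{E}\left[f\left(\frac{S_n}{n^{1/2}}\right)\right]\to \mathbb{E}[f(\xi)]\quad\text{as } n\to\infty.$$
   Context: All notions are standard. *)

(* Defs.v *)
From HB Require Import structures.
From mathcomp Require Import all_boot all_order all_algebra finmap.
From mathcomp Require Import all_classical all_reals all_analysis.
Set Implicit Arguments.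
Unset Strict Implicit.
Unset Printing Implicit Defensive.
Import Order.TTheory GRing.Theory Num.Theory.
Import numFieldNormedType.Exports.
Local Open Scope classical_set_scope.
Local Open Scope ring_scope.

(* R^d is 'rV[R]_d, with the Borel sigma-algebra of its library topology. *)
HB.instance Definition _ (R : realType) (m n : nat) :=
  Measurable.copy 'M[R]_(m, n) (g_sigma_algebraType (@open 'M[R]_(m, n))).

Section random_vectors.
Context {d0 : measure_display} {T : measurableType d0} {R : realType}.
Variable P : probability T R.

Definition mutually_independent {d1 : measure_display} {E : measurableType d1}
    (I : choiceType) (X : I -> {RV P >-> E}) : Prop :=
  forall (J : {fset I}) (A : I -> set E), (forall i, measurable (A i)) ->
    P (\bigcap_(i in [set` J]) (X i @^-1` A i))
    = (\prod_(i <- J) P (X i @^-1` A i))%E.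

Definition identically_distributed {d1 : measure_display}
    {E : measurableType d1} (I : Type) (X : I -> {RV P >-> E}) : Prop :=
  forall (i j : I) (A : set E), measurable A ->
    distribution P (X i) A = distribution P (X j) A.

Definition coordinate {d : nat} (Y : T -> 'rV[R]_d) (j : 'I_d) : T -> R :=
  fun w => Y w ord0 j.

Definition centered {d : nat} (Y : T -> 'rV[R]_d) : Prop :=
  forall j, coordinate Y j \in Lfun P 1%E /\ 'E_P[coordinate Y j]%E = 0%E.

(* Square-integrability of the coordinates is part of the definition. *)
Definition has_covariance_matrix {d : nat} (Y : T -> 'rV[R]_d)
    (Sigma : 'M[R]_d) : Prop :=
  (forall j, coordinate Y j \in Lfun P 2%:E) /\
  (forall j k, covariance P (coordinate Y j) (coordinate Y k)
               = (Sigma j k)%:E).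

(* [normal_prob m s] has mean [m] and standard deviation [s]; for [s = 0] the
   library's [normal_prob] is not a point mass, hence the first disjunct. *)
Definition gaussian (Y : T -> R) : Prop :=
  (exists m : R, forall A : set R, measurable A ->
     pushforward P Y A = dirac m A) \/
  (exists m s : R, 0 < s /\ forall A : set R, measurable A ->
     pushforward P Y A = normal_prob m s A).

Definition gaussian_vector {d : nat} (Y : T -> 'rV[R]_d) : Prop :=
  forall u : 'rV[R]_d, gaussian (fun w => \sum_(j < d) u ord0 j * Y w ord0 j).

End random_vectors.

(* Main.v *)
Require Import Defs.
From HB Require Import structures.
From mathcomp Require Import all_boot all_order all_algebra finmap.
From mathcomp Require Import all_classical all_reals all_analysis.
From mathcomp Require Import measurable_realfun ring lra.
Import Order.TTheory GRing.Theory Num.Theory.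
Import numFieldNormedType.Exports.
Local Open Scope classical_set_scope.
Local Open Scope ring_scope.

(** Expectations of cos (a + u . Y), over all u and a, determine weak limits: a
    trigonometric Bernstein operator yields, for every e > 0, a trigonometric
    polynomial g with |f x - g x| <= e (1 + |x|^2) for all x, and second moments
    are bounded uniformly in n, so f may be replaced by g. For Y = S_n / sqrt n,
    independence and the angle addition formula give a recursion for
    E[cos (a + u . S_k / sqrt n)] whose distance to cos a * r^k, with
    r = exp (- v / 2n) and v = u Sigma u^T, is controlled by the second-order
    Taylor remainders of one summand. On the Gaussian side, Stein's identity turns
    t |-> E[cos (t (u . xi) + a)] into a solution of phi' = - v t phi. *)

Set Implicit Arguments.
Unset Strict Implicit.
Unset Printing Implicit Defensive.

(** * Taylor remainders *)

(** Real cosines with a free phase [a] stand in for complex characteristic functions: sines are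
    obtained by shifting the phase by [pi / 2], and the family is stable under the addition and
    product-to-sum formulas. In general no trigonometric polynomial is uniformly close to [f] on the
    whole space. The weight 1 + |x|^2 absorbs the discrepancy far out, and the bound on second
    moments then does the work of tightness, with no compact truncation and no inversion formula.
    Two obstacles shape the rest. Independence is given for finitely many events at a time, so its
    integral form is derived for bounded functions through their level sets, and reaches partial
    sums by keeping a cylinder event in the induction. Unbounded factors are treated as limits of
    [n sin (x / n)], which is bounded in [x] and dominated by [|x|]. On the Gaussian side a scalar
    law may be a point mass, or a normal law whose mean and standard deviation are not known in
    advance; the latter two are recovered from Stein's identity. *)

Lemma mvt0 (R : realType) (f df : R -> R) (x : R) :
  (forall y : R, is_derive y (1 : R) f (df y)) -> f 0 = 0 ->
  exists2 c : R, `|c| <= `|x| & f x = df c * x.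
Proof.
move=> fdf f0.
have cf (a b : R) : {within `[a, b], continuous f}.
  by apply: continuous_subspaceT => y; apply: differentiable_continuous;
     apply/derivable1_diffP; exact: ex_derive.
have [x0|x0] := leP 0 x.
  have [c] := MVT_segment x0 (fun y _ => fdf y) (cf _ _).
  rewrite in_itv /= f0 !subr0 => /andP[c0 cx] ->; exists c => //.
  by rewrite !ger0_norm.
have [c] := MVT_segment (ltW x0) (fun y _ => fdf y) (cf _ _).
rewrite in_itv /= f0 !sub0r => /andP[c0 cx] /eqP.
rewrite mulrN eqr_opp => /eqP ->; exists c => //.
by rewrite ler0_norm // ltr0_norm // lerN2.
Qed.

Lemma normr_sin_le (R : realType) (x : R) : `|sin x| <= `|x|.
Proof.
have [c _ ->] := @mvt0 R sin cos x (@is_derive_sin R) (sin0 R).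
rewrite normrM ler_piMl// ler_norml.
by rewrite cos_geN1 cos_le1.
Qed.

Lemma normr_onem_cos_le (R : realType) (x : R) : `|1 - cos x| <= `|x|.
Proof.
have dc (y : R) : is_derive y (1 : R) (fun z => 1 - cos z) (sin y).
  by apply: is_derive_eq; rewrite /GRing.scale /=; ring.
have [|c cx ->] := @mvt0 R (fun z => 1 - cos z) sin x dc.
  by rewrite cos0 subrr.
rewrite normrM ler_piMl// ler_norml.
by rewrite sin_geN1 sin_le1.
Qed.

Lemma normr_onem_cos_le_sqr (R : realType) (x : R) : `|1 - cos x| <= x ^+ 2.
Proof.
have dc (y : R) : is_derive y (1 : R) (fun z => 1 - cos z) (sin y).
  by apply: is_derive_eq; rewrite /GRing.scale /=; ring.
have [|c cx ->] := @mvt0 R (fun z => 1 - cos z) sin x dc.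
  by rewrite cos0 subrr.
rewrite normrM -[leRHS]ger0_norm ?sqr_ge0// expr2 normrM ler_wpM2r//.
exact: le_trans (normr_sin_le _) cx.
Qed.

(** Along the derivatives [x - sin x], [1 - cos x], [sin x], each use of [mvt0] gains one factor
    [|x|]. Two orders are recorded: the cubic bound gives smallness for small [x], the quadratic one
    a dominating function when only second moments exist. *)
Lemma sin_rem (R : realType) (x : R) :
  `|x - sin x| <= x ^+ 2 /\ `|x - sin x| <= `|x| ^+ 3.
Proof.
have dc (y : R) : is_derive y (1 : R) (fun z => z - sin z) (1 - cos y).
  by apply: is_derive_eq.
have [|c cx ->] := @mvt0 R (fun z => z - sin z) (fun z => 1 - cos z) x dc.
  by rewrite sin0 subrr.
rewrite normrM; split.
  rewrite -[leRHS]ger0_norm ?sqr_ge0// expr2 normrM ler_wpM2r//.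
  exact: le_trans (normr_onem_cos_le _) cx.
rewrite exprSr ler_wpM2r//; apply: le_trans (normr_onem_cos_le_sqr _) _.
by rewrite -[c ^+ 2]real_normK ?num_real// lerXn2r ?nnegrE.
Qed.

Lemma cos_rem (R : realType) (x : R) :
  `|cos x - 1 + x ^+ 2 / 2| <= 2 * x ^+ 2 /\
  `|cos x - 1 + x ^+ 2 / 2| <= `|x| ^+ 3.
Proof.
have dc (y : R) :
    is_derive y (1 : R) (fun z => cos z - 1 + z ^+ 2 / 2) (y - sin y).
  by apply: is_derive_eq; rewrite /GRing.scale /=; field.
have [|c cx ->] := @mvt0 R (fun z => cos z - 1 + z ^+ 2 / 2)
    (fun z => z - sin z) x dc.
  by rewrite cos0 subrr expr0n /= mul0r addr0.
rewrite normrM; split.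
  rewrite -[x ^+ 2]real_normK ?num_real// expr2 mulrA ler_wpM2r//.
  apply: le_trans (ler_normB _ _) _.
  rewrite mulr_natl mulr2n lerD//; exact: le_trans (normr_sin_le _) cx.
rewrite exprSr ler_wpM2r//; apply: le_trans (sin_rem c).1 _.
by rewrite -[c ^+ 2]real_normK ?num_real// lerXn2r ?nnegrE.
Qed.

(** Multiplying [1 - x <= expR (- x)] by [expR x] gives [expR x - 1 - x <= - x * (1 - expR x)], and
    [1 - expR x <= - x]. *)
Lemma expR_rem (R : realType) (x : R) : x <= 0 ->
  `|expR x - 1 - x| <= x ^+ 2.
Proof.
move=> x0; have := expR_ge1Dx x => h1.
have := expR_ge1Dx (- x) => h2.
rewrite ger0_norm; last lra.
have e0 := expR_gt0 x.
have : expR x * (1 - x) <= 1.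
  by rewrite -{2}(expRxMexpNx_1 x) ler_wpM2l ?expR_ge0//.
have : expR x <= 1 by rewrite -expR0 ler_expR.
nra.
Qed.

(** * Expectations of products *)

Lemma Rintegral_lim d (T : measurableType d) (R : realType)
    (mu : {measure set T -> \bar R}) (f_ : nat -> T -> R) (f g : T -> R) :
  (forall n, measurable_fun setT (f_ n)) ->
  (forall w, f_ n w @[n --> \oo] --> f w) ->
  (forall n w, `|f_ n w| <= g w) ->
  mu.-integrable setT (EFin \o g) ->
  \int[mu]_w f_ n w @[n --> \oo] --> \int[mu]_w f w.
Proof.
move=> mf_ f_f fg Ig; apply: fine_cvg.
have mf : measurable_fun setT f.
  by apply: (@measurable_fun_cvg _ _ _ _ f_) => // w _.
have mEf_ n : measurable_fun setT (fun w => (f_ n w)%:E) by exact/measurable_EFinP.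
have mEf : measurable_fun setT (fun w => (f w)%:E) by exact/measurable_EFinP.
have Ef_f w : (f_ n w)%:E @[n --> \oo] --> (f w)%:E.
  by apply: cvg_EFin (f_f w); exact: nearW.
have aef : {ae mu, forall w, setT w -> (f_ n w)%:E @[n --> \oo] --> (f w)%:E}.
  by apply: aeW => w _; exact: Ef_f.
have aeg : {ae mu, forall w n, setT w -> (`|(f_ n w)%:E| <= (g w)%:E)%E}.
  by apply: aeW => w n _; rewrite lee_fin.
have [If _ cf] := dominated_convergence measurableT mEf_ mEf aef Ig aeg.
by rewrite fineK //; exact: integrable_fin_num.
Qed.

Section expectation.
Context d (T : measurableType d) (R : realType) (P : probability T R).
Implicit Types (f g W G : T -> R).

Lemma Rintegral_cstT (c : R) : \int[P]_w c = c.
Proof.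
rewrite Rintegral_cst// [X in fine X](_ : _ = 1%E) ?mulr1//.
exact: probability_setT.
Qed.

Lemma integrable_bounded (f : T -> R) (M : R) :
  measurable_fun setT f -> (forall w, `|f w| <= M) ->
  P.-integrable setT (EFin \o f).
Proof.
move=> mf fM; apply: measurable_bounded_integrable => //.
  by rewrite -ge0_fin_numE ?fin_num_measure.
exists M; split; first exact: num_real.
by move=> x Mx w _ /=; exact: le_trans (fM w) (ltW Mx).
Qed.

Lemma le_norm_Rintegral_bounded (f : T -> R) (M : R) :
  measurable_fun setT f -> (forall w, `|f w| <= M) ->
  `|\int[P]_w f w| <= M.
Proof.
move=> mf fM.
have If := integrable_bounded mf fM.
apply: le_trans (le_normr_Rintegral measurableT If) _.
have -> : M = \int[P]_w (cst M w).
  by rewrite Rintegral_cstT.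
apply: le_Rintegral => //.
  by apply: (@integrable_bounded _ M) => [|w];
    [exact: measurableT_comp|rewrite normr_id].
by apply: (@integrable_bounded _ `|M|) => [|w] //; exact: measurable_cst.
Qed.

End expectation.

(** For [0 <= z] this is the minimum of [N] and the integer part of [z]. Writing it as a sum of
    indicators of [k <= z], for [k] from 1 to [N], makes it linear in indicators of level sets. *)
Fixpoint level_count (R : realType) (N : nat) (z : R) : R :=
  if N is k.+1 then level_count k z + (k.+1%:R <= z)%R%:R else 0.

Lemma level_count_approx (R : realType) (N : nat) (z : R) : 0 <= z ->
  (N%:R <= z -> level_count N z = N%:R) /\
  (z <= N%:R -> z - 1 <= level_count N z <= z).
Proof.
move=> z0; elim: N => [|k [IH1 IH2]] /=.
  by split=> // z0'; apply/andP; split; lra.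
have k1 : (k.+1%:R : R) = k%:R + 1 by rewrite -natr1.
split=> [kz|zk].
  by rewrite kz IH1 ?k1 //; lra.
have [zk'|zk'] := leP z k%:R.
  have -> : (k.+1%:R <= z) = false by apply/negbTE; rewrite -ltNge k1; lra.
  by rewrite addr0 IH2.
rewrite IH1 ?(ltW zk')//; have [kz|kz] := leP k.+1%:R z => /=.
  by apply/andP; split; lra.
by apply/andP; split; lra.
Qed.

Section product.
Context d (T : measurableType d) (R : realType) (P : probability T R).

Lemma measurable_level (G : T -> R) (c : R) : measurable_fun setT G ->
  measurable_fun setT (fun w => (c <= G w)%R%:R : R).
Proof.
move=> mG.
have mA : measurable [set w | c <= G w].
  have -> : [set w | c <= G w] = setT `&` G @^-1` `[c, +oo[.
    by apply/seteqP; split=> [w|w []] /=; rewrite in_itv /= andbT.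
  exact: mG.
rewrite (_ : (fun _ => _) = \1_[set w | c <= G w]).
  exact: measurable_indic.
by apply/funext => w; rewrite indicE mem_setE.
Qed.

(* The bound |G - level_count N (N G) / N| <= 1 / N reduces the identity to the
   level sets of G. *)
Lemma Rintegral_mul_levels (G W : T -> R) (M : R) :
  measurable_fun setT G -> measurable_fun setT W ->
  (forall w, 0 <= G w <= 1) -> (forall w, `|W w| <= M) ->
  (forall c, \int[P]_w ((c <= G w)%R%:R * W w)
             = \int[P]_w (c <= G w)%R%:R * \int[P]_w W w) ->
  \int[P]_w (G w * W w) = \int[P]_w G w * \int[P]_w W w.
Proof.
move=> mG mW G01 WM H.
(* A point of [T] yields [0 <= M]; on an empty [T] every function is zero and both sides vanish. *)
have [w0|T0] := pselect (exists w : T, True); last first.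
  have T0' (h : T -> R) : \int[P]_w h w = 0.
    rewrite (_ : h = cst 0) ?Rintegral_cstT//.
    by apply/funext => w; exfalso; apply: T0; exists w.
  by rewrite !T0' mul0r.
have M0 : 0 <= M by case: w0 => w _; exact: le_trans (normr_ge0 _) (WM w).
pose L N w : R := level_count N (N%:R * G w).
have mlev (N : nat) (c : R) : (0 < N)%N ->
    (fun w => (c <= N%:R * G w)%R%:R : R) = (fun w => (c / N%:R <= G w)%R%:R : R).
  move=> N0; apply/funext => w.
  by rewrite ler_pdivrMr ?ltr0n// mulrC.
have mL' (N k : nat) : (0 < N)%N ->
    measurable_fun setT (fun w => level_count k (N%:R * G w)).
  move=> N0; elim: k => [|k IH] /=; first exact: measurable_cst.
  by apply: measurable_funD => //; rewrite mlev//; exact: measurable_level.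
have lc_bd (k : nat) (z : R) : `|level_count k z| <= k%:R.
  elim: k => [|k IH] /=; first by rewrite normr0.
  rewrite -natr1; apply: le_trans (ler_normD _ _) _; apply: lerD => //.
  by rewrite normr_nat lern1 leq_b1.
(* The identity is linear in its first factor, so it passes from single level sets to their sums. *)
have HL (N k : nat) : (0 < N)%N ->
    \int[P]_w (level_count k (N%:R * G w) * W w)
    = \int[P]_w level_count k (N%:R * G w) * \int[P]_w W w.
  move=> N0; elim: k => [|k IH] /=.
    rewrite Rintegral_cstT mul0r -[RHS](Rintegral_cstT P).
    by apply: eq_Rintegral => w _; rewrite mul0r.
  have mlv c : measurable_fun setT (fun w => (c <= N%:R * G w)%R%:R : R).
    by rewrite mlev//; exact: measurable_level.
  have blv c w : `|(c <= N%:R * G w)%R%:R : R| <= 1.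
    by rewrite normr_nat lern1 leq_b1.
  under eq_Rintegral do rewrite mulrDl.
  rewrite !RintegralD//.
  - rewrite IH mulrDl; congr (_ + _).
    have := mlev N k.+1%:R N0 => E.
    rewrite (_ : (fun w => (k.+1%:R <= N%:R * G w)%R%:R * W w) =
      (fun w => (k.+1%:R / N%:R <= G w)%R%:R * W w)); last first.
      by apply/funext => w; rewrite (congr1 (fun h => h w) E).
    by rewrite H E.
  - apply: (@integrable_bounded _ _ _ _ _ (k%:R * M)).
      by apply: measurable_funM => //; exact: mL'.
    by move=> w; rewrite normrM ler_pM.
  - apply: (@integrable_bounded _ _ _ _ _ (1 * M)).
      exact: measurable_funM.
    by move=> w; rewrite normrM ler_pM.
  - by apply: (@integrable_bounded _ _ _ _ _ k%:R) => //; exact: mL'.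
  - by apply: (@integrable_bounded _ _ _ _ _ 1).
have G1 w : `|G w| <= 1.
  by have /andP[g0 g1] := G01 w; rewrite ger0_norm.
have cL w : N.+1%:R^-1 * L N.+1 w @[N --> \oo] --> G w.
  apply/cvgrPdist_le => e e0.
  have := @near_infty_natSinv_lt R (PosNum e0).
  apply: filterS => N /= Ne; apply: le_trans (ltW Ne).
  have /andP[g0 g1] := G01 w.
  have N0 : (0 : R) < N.+1%:R by rewrite ltr0n.
  have z0 : 0 <= N.+1%:R * G w by rewrite mulr_ge0 // ltW.
  have [_ /(_ _)] := level_count_approx N.+1 z0.
  rewrite ler_piMr ?(ltW N0)// => /(_ isT) /andP[h1 h2].
  rewrite (_ : G w - _ = N.+1%:R^-1 * (N.+1%:R * G w - L N.+1 w)).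
    rewrite normrM ger0_norm ?invr_ge0 ?(ltW N0)// ler_piMr ?invr_ge0 ?(ltW N0)//.
    by rewrite ger0_norm; rewrite /L; lra.
  by rewrite mulrBr mulKf ?gt_eqF.
have bL N w : `|N.+1%:R^-1 * L N.+1 w| <= 1.
  rewrite normrM ger0_norm ?invr_ge0 ?ler0n//.
  by rewrite ler_pdivrMl ?ltr0n// mulr1; exact: lc_bd.
have mL N : measurable_fun setT (fun w => N.+1%:R^-1 * L N.+1 w).
  by apply: measurable_funM => //; exact: mL'.
have I1 : P.-integrable setT (EFin \o cst (1 : R)).
  by apply: (@integrable_bounded _ _ _ _ _ 1) => // w; rewrite normr1.
have IM : P.-integrable setT (EFin \o cst (1 * M)).
  by apply: (@integrable_bounded _ _ _ _ _ `|1 * M|).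
have c1 := Rintegral_lim mL cL bL I1.
have c2 : \int[P]_w (N.+1%:R^-1 * L N.+1 w * W w) @[N --> \oo] -->
    \int[P]_w (G w * W w).
  apply: (Rintegral_lim _ _ _ IM) => [N|w|N w].
  - exact: measurable_funM.
  - by apply: cvgMr_tmp; exact: cL.
  - by rewrite normrM ler_pM.
have c3 : \int[P]_w (N.+1%:R^-1 * L N.+1 w) * \int[P]_w W w @[N --> \oo] -->
    \int[P]_w G w * \int[P]_w W w by apply: cvgMr_tmp.
have E N : \int[P]_w (N.+1%:R^-1 * L N.+1 w * W w) =
    \int[P]_w (N.+1%:R^-1 * L N.+1 w) * \int[P]_w W w.
  rewrite RintegralZl//; last first.
    by apply: (@integrable_bounded _ _ _ _ _ N.+1%:R) => [|w]; [exact: mL'|exact: lc_bd].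
  rewrite -mulrA -HL// -RintegralZl//.
    by apply: eq_Rintegral => w _; rewrite mulrA.
  apply: (@integrable_bounded _ _ _ _ _ (N.+1%:R * M)).
    by apply: measurable_funM => //; exact: mL'.
  by move=> w; rewrite normrM ler_pM.
rewrite -(cvg_lim (@Rhausdorff R) c2) -(cvg_lim (@Rhausdorff R) c3).
by under eq_fun do rewrite E.
Qed.

(** An affine change maps [g (V w)] into the unit interval; the level sets of the result are
    preimages under [V] of measurable sets of reals, where the last hypothesis applies. [W] stays an
    arbitrary bounded function because it will be a cylinder indicator times a cosine of a partial
    sum. *)
Lemma Rintegral_mul_indep (V W : T -> R) (g : R -> R) (K M : R) :
  measurable_fun setT V -> measurable_fun setT W -> measurable_fun setT g ->
  (forall x, `|g x| <= K) -> (forall w, `|W w| <= M) ->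
  (forall A : set R, measurable A ->
     \int[P]_w (\1_(V @^-1` A) w * W w) = fine (P (V @^-1` A)) * \int[P]_w W w) ->
  \int[P]_w (g (V w) * W w) = \int[P]_w g (V w) * \int[P]_w W w.
Proof.
move=> mV mW mg gK WM H.
have K0 : 0 <= K by exact: le_trans (normr_ge0 _) (gK 0).
(* The added 1 keeps the scaling factor positive when [K] is zero. *)
pose C := K + 1; have C0 : 0 < C by rewrite /C; lra.
pose G w := (g (V w) / C + 1) / 2.
have mgV : measurable_fun setT (g \o V) by exact: measurableT_comp.
have mG : measurable_fun setT G.
  apply: measurable_funM => //; apply: measurable_funD => //.
  exact: measurable_funM.
have gC w : `|g (V w) / C| <= 1.
  rewrite normrM [X in _ * X]ger0_norm ?invr_ge0 ?(ltW C0)//.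
  by rewrite ler_pdivrMr// mul1r; apply: le_trans (gK _) _; rewrite /C; lra.
have G01 w : 0 <= G w <= 1.
  by have := gC w; rewrite ler_norml => /andP[h1 h2]; apply/andP; split;
    rewrite /G; lra.
have gG w : g (V w) = 2 * C * G w - C.
  by rewrite /G; field; rewrite gt_eqF.
have Glev c : \int[P]_w ((c <= G w)%R%:R * W w)
             = \int[P]_w (c <= G w)%R%:R * \int[P]_w W w.
  pose A := [set x | c <= (g x / C + 1) / 2].
  have mA : measurable A.
    have -> : A = setT `&` (fun x => (g x / C + 1) / 2) @^-1` `[c, +oo[.
      by apply/seteqP; split=> [w|w []] /=; rewrite in_itv /= andbT.
    apply: (_ : measurable_fun setT _) => //.
    apply: measurable_funM => //; apply: measurable_funD => //.
    exact: measurable_funM.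
  have E : (fun w => (c <= G w)%R%:R : R) = \1_(V @^-1` A).
    by apply/funext => w; rewrite indicE mem_setE.
  have mVA : measurable (V @^-1` A) by rewrite -[X in measurable X]setTI; exact: mV.
  rewrite (_ : (fun w => (c <= G w)%R%:R * W w) = (fun w => \1_(V @^-1` A) w * W w)).
    rewrite H// E; congr (_ * _).
    by rewrite /Rintegral integral_indic// setIT.
  by apply/funext => w; rewrite (congr1 (fun h => h w) E).
have := Rintegral_mul_levels mG mW G01 WM Glev => HG.
have G1 w : `|G w| <= 1.
  by have /andP[g0 g1] := G01 w; rewrite ger0_norm.
have IG : P.-integrable setT (EFin \o G) by exact: (@integrable_bounded _ _ _ _ _ 1).
have IW : P.-integrable setT (EFin \o W) by exact: (@integrable_bounded _ _ _ _ _ M).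
have IGW : P.-integrable setT (EFin \o (fun w => G w * W w)).
  apply: (@integrable_bounded _ _ _ _ _ (1 * M)); first exact: measurable_funM.
  by move=> w; rewrite normrM ler_pM.
have IC : P.-integrable setT (EFin \o cst C).
  by apply: (@integrable_bounded _ _ _ _ _ `|C|).
have ZG : P.-integrable setT (EFin \o (fun w => 2 * C * G w)).
  apply: (@integrable_bounded _ _ _ _ _ (`|2 * C| * 1)).
    exact: measurable_funM.
  by move=> w; rewrite normrM ler_wpM2l.
have ZW : P.-integrable setT (EFin \o (fun w => C * W w)).
  apply: (@integrable_bounded _ _ _ _ _ (`|C| * M)).
    exact: measurable_funM.
  by move=> w; rewrite normrM ler_wpM2l.
have ZGW : P.-integrable setT (EFin \o (fun w => 2 * C * (G w * W w))).
  apply: (@integrable_bounded _ _ _ _ _ (`|2 * C| * (1 * M))).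
    by apply: measurable_funM => //; exact: measurable_funM.
  by move=> w; rewrite normrM ler_wpM2l// normrM ler_pM.
have -> : \int[P]_w (g (V w) * W w) = \int[P]_w (2 * C * (G w * W w) - C * W w).
  by apply: eq_Rintegral => w _; rewrite gG; ring.
have -> : \int[P]_w g (V w) = \int[P]_w (2 * C * G w - cst C w).
  by apply: eq_Rintegral => w _; rewrite gG.
rewrite !RintegralB// !RintegralZl// HG Rintegral_cstT.
ring.
Qed.

End product.

(** * Sums of independent variables *)

Section independent_sequence.
Context d (T : measurableType d) (R : realType) (P : probability T R).

(** Bare functions rather than bundled random variables, so that projected or rescaled sequences
    need no repacking. *)
Definition indep_seq (U : nat -> T -> R) : Prop :=
  forall (J : {fset nat}) (A : nat -> set R), (forall i, measurable (A i)) ->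
    P (\bigcap_(i in [set` J]) (U i @^-1` A i))
    = (\prod_(i <- J) P (U i @^-1` A i))%E.

Variable U : nat -> T -> R.
Hypothesis mU : forall i, measurable_fun setT (U i).
Hypothesis indepU : indep_seq U.

Let S k w := \sum_(i < k) U i w.

Lemma measurable_partial_sum k : measurable_fun setT (S k).
Proof.
rewrite /S; elim: k => [|k IH].
  by under eq_fun do rewrite big_ord0; exact: measurable_cst.
under eq_fun do rewrite big_ord_recr /=.
exact: measurable_funD.
Qed.

Let mcos : measurable_fun setT (@cos R).
Proof. by apply: continuous_measurable_fun; exact: continuous_cos. Qed.

Let msin : measurable_fun setT (@sin R).
Proof. by apply: continuous_measurable_fun; exact: continuous_sin. Qed.

Let mcosS a k : measurable_fun setT (fun w => cos (a + S k w)).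
Proof.
apply: measurableT_comp; first by apply: continuous_measurable_fun; exact: continuous_cos.
by apply: measurable_funD => //; exact: measurable_partial_sum.
Qed.

Let cylinder (J : {fset nat}) (A : nat -> set R) :=
  \bigcap_(i in [set` J]) (U i @^-1` A i).

Let mUA i (A : set R) : measurable A -> measurable (U i @^-1` A).
Proof. by move=> mA; rewrite -[X in measurable X]setTI; exact: mU. Qed.

Let mcyl J A : (forall i, measurable (A i)) -> measurable (cylinder J A).
Proof.
move=> mA; apply: fin_bigcap_measurable; first exact: finite_fset.
by move=> i _; exact: mUA.
Qed.

Let cos1 (x : R) : `|cos x| <= 1.
Proof. by rewrite ler_norml cos_geN1 cos_le1. Qed.

Let sin1 (x : R) : `|sin x| <= 1.
Proof. by rewrite ler_norml sin_geN1 sin_le1. Qed.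

Let indic1 (B : set T) w : `|\1_B w : R| <= 1.
Proof. by rewrite indicE normr_nat lern1 leq_b1. Qed.

Let in_fset0_lt k i : i \in (fset0 : {fset nat}) -> (k < i)%N.
Proof. by rewrite in_fset0. Qed.

(** Independence of [S k] from events on the indices from [k] on, tested on cosines. The cylinder is
    there for the induction on [k]: a condition on [U k] can be absorbed into it, so independence of
    blocks never has to be derived from generated sigma-algebras. All phases are included because
    the addition formula shifts them. *)
Definition factorizes k := forall J A a, (forall i, measurable (A i)) ->
  (forall i, i \in J -> (k <= i)%N) ->
  \int[P]_w (\1_(cylinder J A) w * cos (a + S k w))
  = fine (P (cylinder J A)) * \int[P]_w cos (a + S k w).

(** [Rintegral_mul_indep] with [V] equal to [U k] and [W] the cylinder indicator times the cosine.
    Its hypothesis on events of [U k] is [factorizes k] again, for the cylinder enlarged by the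
    index [k]; this is why [J] must lie strictly above [k]. *)
Lemma factorizes_mul k (g : R -> R) J A a : factorizes k ->
  measurable_fun setT g -> (forall x, `|g x| <= 1) ->
  (forall i, measurable (A i)) -> (forall i, i \in J -> (k < i)%N) ->
  \int[P]_w (g (U k w) * (\1_(cylinder J A) w * cos (a + S k w)))
  = \int[P]_w g (U k w) *
    (fine (P (cylinder J A)) * \int[P]_w cos (a + S k w)).
Proof.
move=> Fk mg g1 mA Jk.
have kJ : k \notin J by apply/negP => /Jk; rewrite ltnn.
have Jk' i : i \in J -> (k <= i)%N by move=> /Jk /ltnW.
rewrite -Fk//.
apply: (@Rintegral_mul_indep _ _ _ _ _ _ _ 1 1) => //.
- by apply: measurable_funM => //; apply: measurable_indic; exact: mcyl.
- by move=> w; rewrite normrM -[leRHS]mulr1 ler_pM.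
move=> C mC; rewrite Fk//.
(* [A'] imposes [C] at the index [k] and agrees with [A] on [J]. *)
pose A' i := if i == k then C else A i.
have mA' i : measurable (A' i) by rewrite /A'; case: ifP.
have E : cylinder (k |` J)%fset A' = (U k @^-1` C) `&` cylinder J A.
  apply/seteqP; split=> w /=.
    move=> h; split.
      by have := h k; rewrite /= fset1U1 /A' eqxx; exact.
    move=> i iJ; have := h i; rewrite /= fset1Ur// /A'.
    by case: eqVneq => [ik|_]; [move: kJ; rewrite -ik (_ : i \in J)|exact].
  move=> [hk h] i /=; rewrite /A'; case: eqVneq => [->//|ik].
  by rewrite in_fset1U (negbTE ik) => /h.
have PE : P (cylinder (k |` J)%fset A') =
    (P (U k @^-1` C) * P (cylinder J A))%E.
  rewrite !indepU// big_fsetU1//=; congr (_ * _)%E; first by rewrite /A' eqxx.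
  rewrite big_seq [RHS]big_seq; apply: eq_bigr => i iJ.
  by rewrite /A'; case: eqVneq => // ik; move: kJ; rewrite -ik iJ.
have := @Fk (k |` J)%fset A' a mA'.
rewrite PE fineM ?fin_num_measure//; [|exact: mUA|exact: mcyl].
rewrite -mulrA => <-.
  by apply: eq_Rintegral => w _; rewrite E indicI mulrA.
by move=> i; rewrite in_fset1U => /orP[/eqP->|/Jk'].
Qed.

(** The addition formula splits off [U k]; writing the sine of [a + S k] as a cosine with phase
    [a - pi / 2] keeps both terms within the scope of [factorizes k]. *)
Lemma factorizes_recr k J A a : factorizes k ->
  (forall i, measurable (A i)) -> (forall i, i \in J -> (k < i)%N) ->
  \int[P]_w (\1_(cylinder J A) w * cos (a + S k.+1 w))
  = fine (P (cylinder J A)) *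
    (\int[P]_w cos (U k w) * \int[P]_w cos (a + S k w)
     - \int[P]_w sin (U k w) * \int[P]_w cos (a - pi / 2 + S k w)).
Proof.
move=> Fk mA Jk.
have -> : \int[P]_w (\1_(cylinder J A) w * cos (a + S k.+1 w)) =
  \int[P]_w (cos (U k w) * (\1_(cylinder J A) w * cos (a + S k w))
    - sin (U k w) * (\1_(cylinder J A) w * cos (a - pi / 2 + S k w))).
  apply: eq_Rintegral => w _; rewrite {1}/S big_ord_recr /= addrA cosD.
  rewrite -[\sum_(i < k) U i w]/(S k w).
  by rewrite [a - _ + _]addrAC cosBpihalf; ring.
have mi : measurable_fun setT (\1_(cylinder J A) : T -> R).
  by apply: measurable_indic; exact: mcyl.
have Ib (g : R -> R) b : measurable_fun setT g -> (forall x, `|g x| <= 1) ->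
  P.-integrable setT (EFin \o
    (fun w => g (U k w) * (\1_(cylinder J A) w * cos (b + S k w)))).
  move=> mg g1; apply: (@integrable_bounded _ _ _ _ _ 1).
    by apply: measurable_funM; [exact: measurableT_comp|exact: measurable_funM].
  by move=> w; rewrite !normrM -[leRHS]mulr1 ler_pM// -[leRHS]mulr1 ler_pM.
rewrite RintegralB//; [|exact: Ib..].
rewrite !factorizes_mul//.
ring.
Qed.

Lemma factorizesP k : factorizes k.
Proof.
elim: k => [|k IH] J A a mA Jk.
  have E w : cos (a + S 0 w) = cos a by rewrite /S big_ord0 addr0.
  under eq_Rintegral do rewrite E.
  under [in RHS]eq_Rintegral do rewrite E.
  rewrite Rintegral_cstT RintegralZr//; last first.
    by apply: (@integrable_bounded _ _ _ _ _ 1) => //;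
      apply: measurable_indic; exact: mcyl.
  by rewrite /Rintegral integral_indic ?setIT//; exact: mcyl.
rewrite factorizes_recr//; congr (_ * _).
(* The same recursion over the empty index set, whose cylinder is the whole space, identifies the
   bracket with the integral at [k.+1]. *)
have := @factorizes_recr k fset0 A a IH mA (in_fset0_lt k).
have -> : cylinder fset0 A = setT.
  by apply/seteqP; split=> w //= _ i /=; rewrite in_fset0.
rewrite [X in fine X](_ : _ = 1%E) ?mul1r; last exact: probability_setT.
by move=> <-; apply: eq_Rintegral => w _; rewrite indicT mul1r.
Qed.

Lemma Rintegral_cos_sum_recr k a :
  \int[P]_w cos (a + S k.+1 w) =
    \int[P]_w cos (U k w) * \int[P]_w cos (a + S k w)
    - \int[P]_w sin (U k w) * \int[P]_w cos (a - pi / 2 + S k w).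
Proof.
have := @factorizes_recr k fset0 (fun=> setT) a (@factorizesP k)
  (fun=> measurableT) (in_fset0_lt k).
have -> : cylinder fset0 (fun=> setT) = setT.
  by apply/seteqP; split=> w //= _ i /=; rewrite in_fset0.
rewrite [X in fine X](_ : _ = 1%E) ?mul1r; last exact: probability_setT.
by move=> <-; apply: eq_Rintegral => w _; rewrite indicT mul1r.
Qed.

(** A bounded form of the factorization of the expectation of [U k * S k]; applied to rescaled
    variables it gives the unbounded one in the limit. *)
Lemma Rintegral_sin_mul_sum k :
  \int[P]_w (sin (U k w) * sin (S k w)) =
    \int[P]_w sin (U k w) * \int[P]_w sin (S k w).
Proof.
have := @factorizes_mul k sin fset0 (fun=> setT) (- (pi / 2)) (@factorizesP k)
  msin sin1 (fun=> measurableT) (in_fset0_lt k).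
have -> : cylinder fset0 (fun=> setT) = setT.
  by apply/seteqP; split=> w //= _ i /=; rewrite in_fset0.
rewrite [X in fine X](_ : _ = 1%E) ?mul1r; last exact: probability_setT.
have E w : cos (- (pi / 2) + S k w) = sin (S k w) by rewrite addrC cosBpihalf.
rewrite (@eq_Rintegral _ _ _ P setT (fun w => sin (U k w) * sin (S k w))); last first.
  by move=> w _; rewrite E indicT mul1r.
by move=> ->; congr (_ * _); apply: eq_Rintegral => w _; rewrite E.
Qed.

(* Telescoping against [r ^+ n]. *)
Lemma Rintegral_cos_sum_approx (p q r a : R) n : 0 <= r <= 1 ->
  (forall i, (i < n)%N -> \int[P]_w cos (U i w) = p) ->
  (forall i, (i < n)%N -> \int[P]_w sin (U i w) = q) ->
  `|\int[P]_w cos (a + S n w) - cos a * r ^+ n| <= n%:R * (`|p - r| + `|q|).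
Proof.
move=> /andP[r0 r1] Hp Hq.
have bS b k : `|\int[P]_w cos (b + S k w)| <= 1.
  exact: le_norm_Rintegral_bounded.
elim: n a Hp Hq => [|n IH] a Hp Hq.
  have E w : cos (a + S 0 w) = cos a by rewrite /S big_ord0 addr0.
  under eq_Rintegral do rewrite E.
  by rewrite Rintegral_cstT expr0 mulr1 subrr normr0 mul0r.
rewrite Rintegral_cos_sum_recr Hp// Hq//.
set c := \int[P]_w cos (a + S n w); set s := \int[P]_w cos (_ - _ + S n w).
(* One summand costs the replacement of [p] by [r] and the sine term; the error already accumulated
   is multiplied by [r], at most 1. *)
rewrite (_ : _ - _ = c * (p - r) - q * s + r * (c - cos a * r ^+ n)); last first.
  by rewrite exprS; ring.
have IHa : `|c - cos a * r ^+ n| <= n%:R * (`|p - r| + `|q|).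
  by apply: IH => i iN; [exact: Hp (ltnW _)|exact: Hq (ltnW _)].
apply: le_trans (ler_normD _ _) _; rewrite -natr1 mulrDl mul1r addrC.
apply: lerD.
  by rewrite normrM (ger0_norm r0); apply: le_trans (ler_piMl _ r1) IHa.
apply: le_trans (ler_normB _ _) _; rewrite !normrM; apply: lerD.
  by rewrite ler_piMl ?bS.
by rewrite ler_piMr ?bS.
Qed.

End independent_sequence.

(** * Moments and cosine expectations of normalized sums *)

Lemma cvg_sqrt_inv (R : realType) :
  (Num.sqrt (n%:R : R))^-1 @[n --> \oo] --> (0 : R).
Proof.
apply/cvgrPdist_le => e e0.
have e2 : 0 < e ^+ 2 by rewrite exprn_gt0.
have := @near_infty_natSinv_lt R (PosNum e2).
move=> [N _ HN]; exists N.+1 => // n /= Nn.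
have n0 : (0 < n)%N by exact: leq_trans Nn.
have sn0 : 0 < Num.sqrt (n%:R : R) by rewrite sqrtr_gt0 ltr0n.
rewrite sub0r normrN ger0_norm ?invr_ge0 ?(ltW sn0)//.
rewrite -[leRHS]invrK lef_pV2 ?posrE ?invr_gt0//.
rewrite -(ger0_norm (ltW e0)) -sqrtr_sqr -sqrtrV ?sqr_ge0// ler_wsqrtr//.
rewrite -[leRHS]invrK lef_pV2 ?posrE ?invr_gt0 ?ltr0n//.
have := HN n.-1 (ltac:(by rewrite /= -ltnS prednK)).
by rewrite /= prednK// => /ltW.
Qed.

Lemma sqrt_inv_sqr (R : realType) n : (0 < n)%N ->
  n%:R * (Num.sqrt (n%:R : R))^-1 ^+ 2 = 1.
Proof.
by move=> n0; rewrite exprVn sqr_sqrtr ?ler0n// divff// pnatr_eq0 -lt0n.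
Qed.

(** With the bound by [|x|] below, this is a smooth truncation of the identity: identities known for
    bounded functions extend to [x] itself by dominated convergence. *)
Lemma cvg_natM_sin (R : realType) (x : R) :
  n.+1%:R * sin (n.+1%:R^-1 * x) @[n --> \oo] --> x.
Proof.
apply/cvgrPdist_le => e e0.
(* The error is at most [x ^+ 2 / n.+1]; the summand 1 avoids dividing by zero. *)
have e1 : 0 < e / (1 + x ^+ 2) by rewrite divr_gt0// ltr_pwDl// sqr_ge0.
have := @near_infty_natSinv_lt R (PosNum e1).
apply: filterS => n /= ne.
have n0 : 0 < (n.+1%:R : R) by rewrite ltr0n.
rewrite (_ : x - _ =
    n.+1%:R * (n.+1%:R^-1 * x - sin (n.+1%:R^-1 * x))); last first.
  by rewrite mulrBr mulVKf ?gt_eqF.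
rewrite normrM (ger0_norm (ltW n0)).
apply: (@le_trans _ _ (n.+1%:R * (n.+1%:R^-1 * x) ^+ 2)).
  by rewrite ler_pM2l//; exact: (sin_rem _).1.
rewrite exprMn [_^-1 ^+ 2]expr2 !mulrA mulfV ?gt_eqF// mul1r.
move: ne; rewrite ltr_pdivlMr; last by rewrite ltr_pwDl// sqr_ge0.
have : 0 < (n.+1%:R : R)^-1 by rewrite invr_gt0.
by move: (n.+1%:R^-1 : R) => y y0; nra.
Qed.

Lemma norm_natM_sin (R : realType) n (x : R) : `|n.+1%:R * sin (n.+1%:R^-1 * x)| <= `|x|.
Proof.
have n0 : 0 < (n.+1%:R : R) by rewrite ltr0n.
rewrite normrM (ger0_norm (ltW n0)) -ler_pdivlMl//.
apply: le_trans (normr_sin_le _) _.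
by rewrite normrM ger0_norm ?invr_ge0 ?(ltW n0).
Qed.

Section iid_sequence.
Context d (T : measurableType d) (R : realType) (P : probability T R).

Lemma indep_seq_comp (U : nat -> T -> R) (h : R -> R) :
  measurable_fun setT h -> indep_seq P U ->
  indep_seq P (fun i w => h (U i w)).
Proof.
move=> mh indepU J A mA.
apply: (indepU J (fun i => h @^-1` A i)) => i.
by rewrite -[X in measurable X]setTI; exact: mh.
Qed.

Lemma integrable_dominated (f g : T -> R) : measurable_fun setT f ->
  (forall w, `|f w| <= g w) -> P.-integrable setT (EFin \o g) ->
  P.-integrable setT (EFin \o f).
Proof.
move=> mf fg Ig; apply: (le_integrable measurableT _ _ Ig).
  exact/measurable_EFinP.
by move=> w _ /=; rewrite lee_fin; apply: le_trans (fg w) (ler_norm _).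
Qed.

(** Put [c] for the inverse square root of [n]. The cubic bound makes [n * rho (c * U)] at most
    [c * |U| ^+ 3], which tends to 0 pointwise, while the quadratic bound dominates it by
    [2 * U ^+ 2]. Two moments thus suffice. *)
Lemma cvg_rem (rho : R -> R) (U : T -> R) :
  measurable_fun setT rho -> (forall x, `|rho x| <= 2 * x ^+ 2) ->
  (forall x, `|rho x| <= `|x| ^+ 3) ->
  measurable_fun setT U ->
  P.-integrable setT (EFin \o (fun w => U w ^+ 2)) ->
  n%:R * \int[P]_w rho ((Num.sqrt n%:R)^-1 * U w) @[n --> \oo] --> (0 : R).
Proof.
move=> mrho rho2 rho3 mU IU.
pose c n : R := (Num.sqrt n%:R)^-1.
have c0 n : 0 <= c n by rewrite invr_ge0 sqrtr_ge0.
(* The product equals 1 except at [n = 0], where it vanishes. *)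
have nc n : n%:R * c n ^+ 2 <= 1.
  by case: n => [|n]; rewrite ?mul0r// sqrt_inv_sqr.
have mr n : measurable_fun setT (fun w => rho (c n * U w)).
  by apply: measurableT_comp => //; exact: measurable_funM.
have I2 : P.-integrable setT (EFin \o (fun w => 2 * U w ^+ 2)).
  exact: (integrableZl measurableT 2 IU).
have Ir n : P.-integrable setT (EFin \o (fun w => rho (c n * U w))).
  apply: (@integrable_dominated _ (fun w => c n ^+ 2 * (2 * U w ^+ 2))) => //.
    by move=> w; apply: le_trans (rho2 _) _; rewrite exprMn mulrCA.
  exact: (integrableZl measurableT _ I2).
rewrite (_ : (fun n : nat => _) =
    (fun n => \int[P]_w (n%:R * rho (c n * U w)))); last first.
  by apply/funext => n; rewrite RintegralZl.
rewrite -[X in _ --> X](Rintegral_cstT P).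
apply: (@Rintegral_lim _ _ _ _ _ (cst 0) (fun w => 2 * U w ^+ 2)) => //.
- by move=> n; exact: measurable_funM.
- move=> w; apply: norm_cvg0.
  apply: (@squeeze_cvgr _ _ _ _ (cst 0) (fun n => c n * `|U w| ^+ 3)).
  + apply: nearW => n; rewrite normr_ge0 /= normrM ger0_norm//.
    apply: (@le_trans _ _ (n%:R * (c n ^+ 3 * `|U w| ^+ 3))).
      rewrite ler_wpM2l//; apply: le_trans (rho3 _) _.
      by rewrite normrM exprMn (ger0_norm (c0 n)).
    rewrite (_ : _ * _ = (n%:R * c n ^+ 2) * (c n * `|U w| ^+ 3)); last by ring.
    by rewrite ler_piMl// mulr_ge0// exprn_ge0.
  + exact: cvg_cst.
  + rewrite -(mul0r (`|U w| ^+ 3)).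
    by apply: cvgMr_tmp; exact: cvg_sqrt_inv.
- move=> n w; rewrite normrM ger0_norm//.
  apply: (@le_trans _ _ (n%:R * (2 * (c n * U w) ^+ 2))).
    by rewrite ler_wpM2l.
  rewrite exprMn mulrCA ler_pM2l// mulrA ler_piMl// sqr_ge0//.
Qed.

Section moments.
Variables (U : nat -> T -> R) (v : R).
Hypothesis mU : forall i, measurable_fun setT (U i).
Hypothesis indepU : indep_seq P U.
Hypothesis IU2 : forall i, P.-integrable setT (EFin \o (fun w => U i w ^+ 2)).
Hypothesis EU : forall i, \int[P]_w U i w = 0.
Hypothesis EU2 : forall i, \int[P]_w U i w ^+ 2 = v.

Let S k w := \sum_(i < k) U i w.

Let mS k : measurable_fun setT (S k).
Proof. exact: measurable_partial_sum. Qed.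

Let ler_norm_onesqr (x : R) : `|x| <= 1 + x ^+ 2.
Proof.
rewrite -[x ^+ 2]real_normK ?num_real//; have := sqr_ge0 (`|x| - 1); nra.
Qed.

Let I1 : P.-integrable setT (EFin \o cst (1 : R)).
Proof. by apply: (@integrable_bounded _ _ _ _ _ 1) => // w; rewrite normr1. Qed.

Let I1sqr (f : T -> R) : P.-integrable setT (EFin \o (fun w => f w ^+ 2)) ->
  P.-integrable setT (EFin \o (fun w => 1 + f w ^+ 2)).
Proof. by move=> If; exact: (integrableD measurableT I1 If). Qed.

Let mnsin n (f : T -> R) : measurable_fun setT f ->
  measurable_fun setT (fun w => n.+1%:R * sin (n.+1%:R^-1 * f w)).
Proof.
move=> mf; apply: measurable_funM => //.
apply: (measurableT_comp (f := @sin R)).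
  by apply: continuous_measurable_fun; exact: continuous_sin.
exact: measurable_funM.
Qed.

Let cvg_Rintegral_sin (f : T -> R) : measurable_fun setT f ->
  P.-integrable setT (EFin \o (fun w => f w ^+ 2)) ->
  \int[P]_w (n.+1%:R * sin (n.+1%:R^-1 * f w)) @[n --> \oo] --> \int[P]_w f w.
Proof.
move=> mf If.
apply: (@Rintegral_lim _ _ _ _ _ f (fun w => 1 + f w ^+ 2)) => //.
- by move=> n; exact: mnsin.
- by move=> w; exact: cvg_natM_sin.
- move=> n w; apply: (@le_trans _ _ `|f w|) => //; exact: norm_natM_sin.
- exact: I1sqr.
Qed.

(** Both factors are truncated by [n sin (x / n)]; for the rescaled sequence [V] the expectation of
    the product of sines factorizes, and dominated convergence under [U k ^+ 2 + S k ^+ 2] removes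
    the truncation. The limit has the factor [\int[P]_w U k w], which is zero. *)
Lemma Rintegral_mul_partial_sum k :
  P.-integrable setT (EFin \o (fun w => S k w ^+ 2)) ->
  \int[P]_w (U k w * S k w) = 0.
Proof.
move=> IS.
have c1 := cvg_Rintegral_sin (mU k) (IU2 k).
have c2 := cvg_Rintegral_sin (mS k) IS.
have c12 : \int[P]_w (n.+1%:R * sin (n.+1%:R^-1 * U k w)) *
     \int[P]_w (n.+1%:R * sin (n.+1%:R^-1 * S k w)) @[n --> \oo] -->
    \int[P]_w U k w * \int[P]_w S k w by exact: cvgM.
have c3 : \int[P]_w ((n.+1%:R * sin (n.+1%:R^-1 * U k w)) *
     (n.+1%:R * sin (n.+1%:R^-1 * S k w))) @[n --> \oo] -->
    \int[P]_w (U k w * S k w).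
  apply: (@Rintegral_lim _ _ _ _ _ _ (fun w => U k w ^+ 2 + S k w ^+ 2)).
  - by move=> n; apply: measurable_funM; exact: mnsin.
  - by move=> w; apply: cvgM; exact: cvg_natM_sin.
  - move=> n w; rewrite normrM.
    apply: (@le_trans _ _ (`|U k w| * `|S k w|)); first by apply: ler_pM => //; exact: norm_natM_sin.
    rewrite -[U k w ^+ 2]real_normK ?num_real// -[S k w ^+ 2]real_normK ?num_real//.
    have := normr_ge0 (U k w); have := normr_ge0 (S k w); nra.
  - exact: (integrableD measurableT (IU2 k) IS).
have E n : \int[P]_w ((n.+1%:R * sin (n.+1%:R^-1 * U k w)) *
     (n.+1%:R * sin (n.+1%:R^-1 * S k w))) =
   \int[P]_w (n.+1%:R * sin (n.+1%:R^-1 * U k w)) *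
   \int[P]_w (n.+1%:R * sin (n.+1%:R^-1 * S k w)).
  pose V i w := n.+1%:R^-1 * U i w.
  have mV i : measurable_fun setT (V i) by exact: measurable_funM.
  have indepV : indep_seq P V.
    apply: (@indep_seq_comp U (fun x => n.+1%:R^-1 * x)) => //.
    exact: measurable_funM.
  have SV w : \sum_(i < k) V i w = n.+1%:R^-1 * S k w by rewrite mulr_sumr.
  have msin (f : T -> R) : measurable_fun setT f ->
      measurable_fun setT (fun w => sin (n.+1%:R^-1 * f w)).
    move=> mf; apply: (measurableT_comp (f := @sin R)).
      by apply: continuous_measurable_fun; exact: continuous_sin.
    exact: measurable_funM.
  have sin1 (x : R) : `|sin x| <= 1 by rewrite ler_norml sin_geN1 sin_le1.
  have Is (f : T -> R) : measurable_fun setT f ->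
      P.-integrable setT (EFin \o (fun w => sin (n.+1%:R^-1 * f w))).
    by move=> mf; apply: (@integrable_bounded _ _ _ _ _ 1) => //; exact: msin.
  rewrite (RintegralZl _ measurableT (Is _ (mU k))).
  rewrite (RintegralZl _ measurableT (Is _ (mS k))).
  have := Rintegral_sin_mul_sum mV indepV k.
  under eq_Rintegral do rewrite SV.
  under [X in _ = _ * X]eq_Rintegral do rewrite SV.
  rewrite /V mulrACA => <-.
  rewrite -RintegralZl//; last first.
    apply: (@integrable_bounded _ _ _ _ _ 1).
      by apply: measurable_funM; exact: msin.
    by move=> w; rewrite normrM -[leRHS]mulr1 ler_pM.
  by apply: eq_Rintegral => w _; rewrite mulrACA.
rewrite -(cvg_lim (@Rhausdorff R) c3); under eq_fun do rewrite E.
by rewrite (cvg_lim (@Rhausdorff R) c12) EU mul0r.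
Qed.

(** Integrability belongs to the induction because the vanishing of the cross term presupposes
    it. *)
Lemma partial_sum_sqr k :
  P.-integrable setT (EFin \o (fun w => S k w ^+ 2)) /\
  \int[P]_w S k w ^+ 2 = k%:R * v.
Proof.
elim: k => [|k [IS ES]].
  have E : (fun w => S 0 w ^+ 2) = cst 0.
    by apply/funext => w; rewrite /S big_ord0 expr0n.
  split; last by rewrite mul0r E Rintegral_cstT.
  by rewrite E; apply: (@integrable_bounded _ _ _ _ _ 0) => // w; rewrite normr0.
have E : (fun w => S k.+1 w ^+ 2) =
    (fun w => (S k w ^+ 2 + U k w ^+ 2) + 2 * (U k w * S k w)).
  by apply/funext => w; rewrite /S big_ord_recr /=; ring.
have ISU := integrableD measurableT IS (IU2 k).
have IM : P.-integrable setT (EFin \o (fun w => U k w * S k w)).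
  apply: (@integrable_dominated _ (fun w => S k w ^+ 2 + U k w ^+ 2)) => //.
    exact: measurable_funM.
  move=> w; rewrite normrM.
  rewrite -[U k w ^+ 2]real_normK ?num_real// -[S k w ^+ 2]real_normK ?num_real//.
  have := normr_ge0 (U k w); have := normr_ge0 (S k w); nra.
have I2M := integrableZl measurableT 2 IM.
split; first by rewrite E; exact: (integrableD measurableT ISU I2M).
rewrite E RintegralD// RintegralD// RintegralZl// Rintegral_mul_partial_sum//.
by rewrite ES EU2 mulr0 addr0 -natr1 mulrDl mul1r.
Qed.

(** [Rintegral_cos_sum_approx] is applied with [r n] chosen so that [r n ^+ n] is the limit factor.
    Both [p n] and [r n] are compared with [1 - c n ^+ 2 * (v / 2)], each up to an error that
    vanishes after multiplication by [n]. *)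
Lemma cvg_Rintegral_cos_sum a :
  (forall (g : R -> R) i, measurable_fun setT g -> (forall x, `|g x| <= 1) ->
     \int[P]_w g (U i w) = \int[P]_w g (U 0%N w)) ->
  \int[P]_w cos (a + (Num.sqrt n%:R)^-1 * S n w) @[n --> \oo] -->
    cos a * expR (- (v / 2)).
Proof.
move=> idU.
pose c n : R := (Num.sqrt n%:R)^-1.
have mcos : measurable_fun setT (@cos R).
  by apply: continuous_measurable_fun; exact: continuous_cos.
have msin : measurable_fun setT (@sin R).
  by apply: continuous_measurable_fun; exact: continuous_sin.
have cos1 (x : R) : `|cos x| <= 1 by rewrite ler_norml cos_geN1 cos_le1.
have sin1 (x : R) : `|sin x| <= 1 by rewrite ler_norml sin_geN1 sin_le1.
have v0 : 0 <= v.
  by rewrite -(EU2 0); apply: Rintegral_ge0 => w _; exact: sqr_ge0.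
have mcU n : measurable_fun setT (fun w => c n * U 0%N w).
  exact: measurable_funM.
have IU : P.-integrable setT (EFin \o U 0%N).
  apply: (@integrable_dominated _ (fun w => 1 + U 0%N w ^+ 2)) => //.
  exact: I1sqr.
have IcU n : P.-integrable setT (EFin \o (fun w => c n * U 0%N w)).
  exact: (integrableZl measurableT _ IU).
have Isin n : P.-integrable setT (EFin \o (fun w => sin (c n * U 0%N w))).
  by apply: (@integrable_bounded _ _ _ _ _ 1) => //; exact: measurableT_comp.
have Icos n : P.-integrable setT (EFin \o (fun w => cos (c n * U 0%N w))).
  by apply: (@integrable_bounded _ _ _ _ _ 1) => //; exact: measurableT_comp.
pose p n := \int[P]_w cos (c n * U 0%N w).
pose q n := \int[P]_w sin (c n * U 0%N w).
pose r n := expR (- (v / 2) * c n ^+ 2).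
have qE n : \int[P]_w (c n * U 0%N w - sin (c n * U 0%N w)) = - q n.
  by rewrite RintegralB// RintegralZl// EU mulr0 sub0r.
have pE n : \int[P]_w (cos (c n * U 0%N w) - 1 + (c n * U 0%N w) ^+ 2 / 2) =
    p n - 1 + c n ^+ 2 * (v / 2).
  have -> : \int[P]_w (cos (c n * U 0%N w) - 1 + (c n * U 0%N w) ^+ 2 / 2) =
    \int[P]_w ((cos (c n * U 0%N w) - cst 1 w) + c n ^+ 2 / 2 * U 0%N w ^+ 2).
    by apply: eq_Rintegral => w _ /=; field.
  have I3 := integrableB measurableT (Icos n) I1.
  have I4 := integrableZl measurableT (c n ^+ 2 / 2) (IU2 0%N).
  by rewrite RintegralD// RintegralB// RintegralZl// Rintegral_cstT EU2 -/(p n); field.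
(* Since [U] is centered, [q n] is minus the expectation of the remainder [x - sin x]. *)
have c_q : n%:R * q n @[n --> \oo] --> (0 : R).
  rewrite -oppr0; under eq_fun do rewrite -[q _]opprK -qE mulrN.
  apply: cvgN; apply: (@cvg_rem (fun x => x - sin x)) => //.
  - exact: measurable_funB.
  - move=> x; apply: le_trans (sin_rem x).1 _.
    by rewrite ler_peMl ?sqr_ge0// ler1n.
  - by move=> x; exact: (sin_rem x).2.
have c_p : n%:R * (p n - 1 + c n ^+ 2 * (v / 2)) @[n --> \oo] --> (0 : R).
  under eq_fun do rewrite -pE.
  apply: (@cvg_rem (fun x => cos x - 1 + x ^+ 2 / 2)) => //.
  - apply: measurable_funD; first exact: measurable_funB.
    by apply: measurable_funM => //; exact: measurable_funX.
  - by move=> x; exact: (cos_rem x).1.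
  - by move=> x; exact: (cos_rem x).2.
have c_c : c n @[n --> \oo] --> (0 : R) by exact: cvg_sqrt_inv.
have nc n : n%:R * c n ^+ 2 <= 1.
  by case: n => [|n]; rewrite ?mul0r// sqrt_inv_sqr.
have c0 n : 0 <= c n by rewrite invr_ge0 sqrtr_ge0.
(* The middle term is [n] times the square of the exponent of [r n], simplified by
   [n * c n ^+ 2 = 1]. Positivity of [n] is essential: [r 0 ^+ 0] is 1. *)
have bound n : (0 < n)%N ->
  `|\int[P]_w cos (a + c n * S n w) - cos a * expR (- (v / 2))| <=
   `|n%:R * (p n - 1 + c n ^+ 2 * (v / 2))| + (v / 2) ^+ 2 * c n * c n
   + `|n%:R * q n|.
  move=> n0.
  pose V i w := c n * U i w.
  have mV i : measurable_fun setT (V i) by exact: measurable_funM.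
  have indepV : indep_seq P V.
    by apply: (@indep_seq_comp U (fun x => c n * x)) => //; exact: measurable_funM.
  have SV w : \sum_(i < n) V i w = c n * S n w by rewrite mulr_sumr.
  have x0 : - (v / 2) * c n ^+ 2 <= 0.
    by rewrite mulNr oppr_le0 mulr_ge0 ?sqr_ge0// divr_ge0.
  have r01 : 0 <= r n <= 1 by rewrite expR_ge0 /= -expR0 ler_expR.
  have rn : r n ^+ n = expR (- (v / 2)).
    by rewrite -expRM_natl mulrCA sqrt_inv_sqr// mulr1.
  have := @Rintegral_cos_sum_approx _ _ _ P V mV indepV (p n) (q n) (r n) a n r01.
  rewrite rn; under eq_Rintegral do rewrite SV.
  move=> h; apply: le_trans (h _ _) _.
  - move=> i _; apply: (idU (fun x => cos (c n * x)) i) => //.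
    by apply: measurableT_comp => //; exact: measurable_funM.
  - move=> i _; apply: (idU (fun x => sin (c n * x)) i) => //.
    by apply: measurableT_comp => //; exact: measurable_funM.
  rewrite mulrDr normrM (ger0_norm (ler0n _ _)); apply: lerD; last first.
    by rewrite normrM (ger0_norm (ler0n _ _)).
  have -> : p n - r n = (p n - 1 + c n ^+ 2 * (v / 2)) -
      (expR (- (v / 2) * c n ^+ 2) - 1 - (- (v / 2) * c n ^+ 2)).
    by rewrite /r; ring.
  apply: (@le_trans _ _ (n%:R * (`|p n - 1 + c n ^+ 2 * (v / 2)| +
      (- (v / 2) * c n ^+ 2) ^+ 2))).
    rewrite ler_wpM2l//; apply: le_trans (ler_normB _ _) _.
    by rewrite lerD2l; exact: expR_rem.
  rewrite mulrDr lerD2l.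
  have -> : n%:R * (- (v / 2) * c n ^+ 2) ^+ 2 =
    (n%:R * c n ^+ 2) * ((v / 2) ^+ 2 * c n * c n) by ring.
  by rewrite ler_piMl// -mulrA mulr_ge0 ?sqr_ge0// mulr_ge0.
apply/subr_cvg0; apply: norm_cvg0.
apply: (@squeeze_cvgr _ _ _ _ (cst 0) (fun n =>
   `|n%:R * (p n - 1 + c n ^+ 2 * (v / 2))| + (v / 2) ^+ 2 * c n * c n
   + `|n%:R * q n|)).
- exists 1%N => // n /= n0; rewrite normr_ge0 /=; exact: bound.
- exact: cvg_cst.
- have h : `|n%:R * (p n - 1 + c n ^+ 2 * (v / 2))| + (v / 2) ^+ 2 * c n * c n
      + `|n%:R * q n| @[n --> \oo] --> `|0 : R| + (v / 2) ^+ 2 * 0 * 0 + `|0 : R|.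
    apply: cvgD; last exact: cvg_norm.
    apply: cvgD; first exact: cvg_norm.
    by apply: cvgM => //; apply: cvgM => //; exact: cvg_cst.
  by move: h; rewrite normr0 mulr0 !addr0.
Qed.

End moments.

End iid_sequence.

(** * The Gaussian law *)

Section density.
Context d (T : measurableType d) (R : realType).
Variables (nu : {finite_measure set T -> \bar R})
          (mu : {sigma_finite_measure set T -> \bar R}) (p : T -> R).
Hypothesis p0 : forall x, 0 <= p x.
Hypothesis Ip : mu.-integrable setT (EFin \o p).
Hypothesis nu_p : forall A, measurable A -> nu A = (\int[mu]_(x in A) (p x)%:E)%E.
Hypothesis numu : nu `<< mu.

(** Equality of integrals over all measurable sets identifies [p] almost everywhere with the
    Radon-Nikodym derivative, whose change of variables gives the formula. Integrability of [g * p]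
    comes from the formula for [|g|], as [p] is nonnegative. *)
Lemma integral_density (g : T -> R) : nu.-integrable setT (EFin \o g) ->
  mu.-integrable setT (EFin \o (fun x => g x * p x)) /\
  (\int[mu]_x (g x * p x)%:E = \int[nu]_x (g x)%:E)%E.
Proof.
move=> Ig.
have mg : measurable_fun setT g.
  by have /integrableP[/measurable_EFinP] := Ig.
have mp : measurable_fun setT p.
  by have /integrableP[/measurable_EFinP] := Ip.
pose D := Radon_Nikodym (charge_of_finite_measure nu) mu.
have mD : measurable_fun setT D.
  by have /integrableP[] := @Radon_Nikodym_integrable _ _ _
    (charge_of_finite_measure nu) mu numu.
have pD : ae_eq mu setT (EFin \o p) D.
  apply: integral_ae_eq => // E _ mE.
  by rewrite -Radon_Nikodym_integral// -nu_p.
have mgp : measurable_fun setT (fun x => g x * p x) by exact: measurable_funM.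
have E (h : T -> R) : nu.-integrable setT (EFin \o h) ->
    (\int[mu]_x (h x * p x)%:E = \int[nu]_x (h x)%:E)%E.
  move=> Ih; rewrite -(Radon_Nikodym_change_of_variables numu)//.
  have mh : measurable_fun setT h.
    by have /integrableP[/measurable_EFinP] := Ih.
  apply: ae_eq_integral => //.
  - by apply/measurable_EFinP; exact: measurable_funM.
  - apply: emeasurable_funM => //; exact/measurable_EFinP.
  - by apply: filterS pD => x /= pDx _; rewrite EFinM pDx.
split; last exact: E.
apply/integrableP; split; first exact/measurable_EFinP.
have In : nu.-integrable setT (EFin \o (fun x => `|g x|)).
  exact: (integrable_norm Ig).
have := E _ In; under eq_integral do rewrite -[p _]ger0_norm// -normrM.
move=> ->.
by have /integrableP[_] := In; under eq_integral do rewrite /= normr_id.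
Qed.

End density.

Section gaussian_cos.
Context d (T : measurableType d) (R : realType) (P : probability T R).
Variables (Y : T -> R) (m s : R).
Hypothesis mY : measurable_fun setT Y.
Hypothesis s0 : 0 < s.
Hypothesis lawY :
  forall A : set R, measurable A -> pushforward P Y A = normal_prob m s A.

Let p := @normal_pdf R m s.
Let mu := @lebesgue_measure R.

Let sN0 : s != 0. Proof. by rewrite gt_eqF. Qed.

Lemma Rintegral_normal_law (g : R -> R) : measurable_fun setT g ->
  P.-integrable setT (EFin \o (fun w => g (Y w))) ->
  mu.-integrable setT (EFin \o (fun x => g x * p x)) /\
  \int[mu]_x (g x * p x) = \int[P]_w g (Y w).
Proof.
move=> mg Ig.
(* The law of Y lives on the copy of R carrying the Lebesgue measure. *)
have mY' : measurable_fun setT (Y : T -> measurableTypeR R) by exact: mY.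
have mg' : measurable_fun setT (g : measurableTypeR R -> R) by exact: mg.
have mEg : measurable_fun setT (fun x : measurableTypeR R => (g x)%:E).
  exact/measurable_EFinP.
pose Y' : {mfun T >-> measurableTypeR R} := 
  HB.pack Y (@isMeasurableFun.Build _ _ T (measurableTypeR R) Y mY').
have E (f : measurableTypeR R -> \bar R) :
    (\int[normal_prob m s]_x f x = \int[pushforward P Y']_x f x)%E.
  by apply: eq_measure_integral => A mA _; exact: (esym (lawY mA)).
have Ig' : (normal_prob m s).-integrable setT (EFin \o g).
  have /integrableP[_ h] := integrable_pushforward mY' mEg Ig measurableT.
  apply/integrableP; split => //.
  by rewrite E.
have [h1 h2] := @integral_density _ _ _ (normal_prob m s) mu p
  (normal_pdf_ge0 m s) (integrable_normal_pdf m s) (fun A _ => erefl)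
  (normal_prob_dominates m s) g Ig'.
split=> //.
rewrite /Rintegral h2 E.
by rewrite (integral_pushforward mY' mEg Ig measurableT).
Qed.

Let is_derive_pdf (x : R) : is_derive x (1 : R) p (- ((x - m) / s ^+ 2) * p x).
Proof.
rewrite /p normal_pdfE// /normal_fun; apply: is_derive_eq.
move: (expR _) => e; rewrite /GRing.scale /= -mulr_natr; field.
exact: sN0.
Qed.

Let pdf_bound (x : R) : p x <= normal_peak s * (1 + (x - m) ^+ 2 / (s ^+ 2 *+ 2))^-1.
Proof.
rewrite /p normal_pdfE// ler_wpM2l ?normal_peak_ge0//.
have y0 : 0 <= (x - m) ^+ 2 / (s ^+ 2 *+ 2).
  by rewrite divr_ge0 ?sqr_ge0// mulrn_wge0 ?sqr_ge0.
rewrite /normal_fun mulNr expRN lef_pV2 ?posrE ?expR_gt0//.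
  exact: expR_ge1Dx.
by rewrite ltr_pwDl.
Qed.

(** This makes the boundary terms in Stein's identity vanish. With [y] the exponent of the density,
    [|x|] is at most [|m| + |x - m|], the last term is at most [1 + (x - m) ^+ 2], and
    [(x - m) ^+ 2] is [y] times [s ^+ 2 *+ 2]; [pdf_bound] then cancels the factor [1 + y]. *)
Let pdf_decay : exists C : R, forall x, `|x| * p x <= C.
Proof.
exists (normal_peak s * (`|m| + 1 + s ^+ 2 *+ 2)) => x.
set y := (x - m) ^+ 2 / (s ^+ 2 *+ 2).
have s2 : 0 < s ^+ 2 *+ 2 by rewrite mulrn_wgt0// exprn_gt0.
have y0 : 0 <= y by rewrite divr_ge0 ?sqr_ge0// ltW.
have xy : `|x| <= (`|m| + 1 + s ^+ 2 *+ 2) * (1 + y).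
  have -> : x = m + (x - m) by ring.
  apply: le_trans (ler_normD _ _) _.
  have : (x - m) ^+ 2 = s ^+ 2 *+ 2 * y.
    by rewrite /y mulrCA divff ?mulr1// gt_eqF.
  rewrite -real_normK ?num_real//.
  have := normr_ge0 m; have := normr_ge0 (x - m).
  move: (`|x - m|) (`|m|) (s ^+ 2 *+ 2) s2 => u M c c0 u0 M0 uc.
  have : 2 * u <= 1 + u ^+ 2 by have := sqr_ge0 (u - 1); nra.
  nra.
apply: (@le_trans _ _ (`|x| * (normal_peak s * (1 + y)^-1))).
  by rewrite ler_wpM2l//; exact: pdf_bound.
rewrite mulrCA ler_wpM2l ?normal_peak_ge0// ler_pdivrMr ?ltr_pwDl//.
Qed.

Let mcos : measurable_fun setT (@cos R).
Proof. by apply: continuous_measurable_fun; exact: continuous_cos. Qed.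

Let msin : measurable_fun setT (@sin R).
Proof. by apply: continuous_measurable_fun; exact: continuous_sin. Qed.

Let cos1 (x : R) : `|cos x| <= 1.
Proof. by rewrite ler_norml cos_geN1 cos_le1. Qed.

Let sin1 (x : R) : `|sin x| <= 1.
Proof. by rewrite ler_norml sin_geN1 sin_le1. Qed.

Hypothesis IY : P.-integrable setT (EFin \o Y).

(* Stein's identity: integrate the derivative of x |-> cos (t x + a) p(x). *)
Lemma stein_cos t a :
  \int[P]_w ((Y w - m) * cos (t * Y w + a)) =
  - s ^+ 2 * t * \int[P]_w sin (t * Y w + a).
Proof.
pose F x := cos (t * x + a) * p x.
pose g x := - t * sin (t * x + a) - (x - m) / s ^+ 2 * cos (t * x + a).
have mlin : measurable_fun setT (fun x : R => t * x + a).
  by apply: measurable_funD => //; exact: measurable_funM.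
have mcl : measurable_fun setT (fun x : R => cos (t * x + a)).
  exact: measurableT_comp.
have msl : measurable_fun setT (fun x : R => sin (t * x + a)).
  exact: measurableT_comp.
have mg : measurable_fun setT g.
  apply: measurable_funB; first exact: measurable_funM.
  apply: measurable_funM => //; apply: measurable_funM => //.
  exact: measurable_funB.
have dF x : is_derive x (1 : R) F (g x * p x).
  have dp := is_derive_pdf x.
  by rewrite /F; apply: is_derive_eq; rewrite /GRing.scale /= /g; ring.
have cF x : F y @[y --> x] --> F x.
  by apply: differentiable_continuous; apply/derivable1_diffP; exact: ex_derive.
have Ic : P.-integrable setT (EFin \o cst (`|t| + `|m| / s ^+ 2)).
  by apply: (@integrable_bounded _ _ _ _ _ `|(`|t| + `|m| / s ^+ 2)|).
have InY : P.-integrable setT (EFin \o (fun w => (s ^+ 2)^-1 * `|Y w|)).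
  exact: (integrableZl measurableT _ (integrable_norm IY)).
have s2 : 0 <= (s ^+ 2)^-1 by rewrite invr_ge0 sqr_ge0.
have IgY : P.-integrable setT (EFin \o (fun w => g (Y w))).
  apply: (@integrable_dominated _ _ _ _ _
    (fun w => (`|t| + `|m| / s ^+ 2) + (s ^+ 2)^-1 * `|Y w|)).
  - exact: measurableT_comp.
  - move=> w; rewrite /g; apply: le_trans (ler_normB _ _) _.
    rewrite !normrM normrN (ger0_norm s2) -addrA lerD//; first by rewrite ler_piMr.
    apply: (@le_trans _ _ (`|Y w - m| / s ^+ 2)).
      by rewrite ler_piMr// mulr_ge0.
    rewrite [_^-1 * _]mulrC -mulrDl ler_wpM2r// [leRHS]addrC.
    exact: ler_normB.
  - exact: (integrableD measurableT Ic InY).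
have [Igp Egp] := Rintegral_normal_law mg IgY.
have E0 : \int[P]_w g (Y w) = 0.
  rewrite -Egp.
  (* The integral over the line is the limit of integrals over growing segments, each equal to a
     difference of endpoint values of [F]. Using [n.+1] keeps every segment nondegenerate. *)
  pose D n : set R := `[- n.+1%:R, n.+1%:R]%classic.
  pose h n := (fun x => g x * p x) \_ (D n).
  have ch : \int[mu]_x h n x @[n --> \oo] --> \int[mu]_x (g x * p x).
    apply: (@Rintegral_lim _ _ _ mu h _ (fun x => `|g x * p x|)).
    - move=> n; apply/measurable_restrict => //.
        exact: measurable_itv.
      rewrite setTI; apply: measurable_funTS.
      by have /integrableP[/measurable_EFinP] := Igp.
    - move=> x; apply: cvg_near_cst.
      near=> n; rewrite /h patchE ifT// inE /D /= in_itv /= -ler_norml.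
      apply: (@le_trans _ _ n%:R); last by rewrite ler_nat.
      near: n; exact: nbhs_infty_ger.
    - by move=> n x; rewrite /h patchE; case: ifP => // _; rewrite normr0.
    - exact: (integrable_norm Igp).
  have hE n : \int[mu]_x h n x = F n.+1%:R - F (- n.+1%:R).
    rewrite /h -Rintegral_mkcond /Rintegral (@continuous_FTC2 _ _ F)//.
    + by rewrite gtrN// ltr0n.
    + apply: continuous_subspaceT => x.
      apply: differentiable_continuous; apply/derivable1_diffP.
      have dp := is_derive_pdf x.
      by rewrite /g; exact: ex_derive.
    + split.
      * by move=> x _; exact: ex_derive.
      * exact: (cvg_at_right_filter (cF _)).
      * exact: (cvg_at_left_filter (cF _)).
    + by move=> x _; rewrite derive1E; exact: derive_val.
  have [C HC] := pdf_decay.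
  have c0 : F n.+1%:R - F (- n.+1%:R) @[n --> \oo] --> (0 : R).
    have FC n (x : R) : `|x| = n.+1%:R -> `|F x| <= C * n.+1%:R^-1.
      move=> xn; have p0 : 0 <= p x by exact: normal_pdf_ge0.
      rewrite ler_pdivlMr ?ltr0n// mulrC -xn; apply: le_trans (HC x).
      by rewrite ler_wpM2l// normrM (ger0_norm p0) ler_piMl.
    apply: norm_cvg0.
    apply: (@squeeze_cvgr _ _ _ _ (cst 0) (fun n => 2 * C * n.+1%:R^-1)).
    + apply: nearW => n; rewrite normr_ge0 /=.
      apply: le_trans (ler_normB _ _) _.
      rewrite -mulrA mulr_natl mulr2n lerD// FC//.
        by rewrite ger0_norm.
      by rewrite normrN ger0_norm.
    + exact: cvg_cst.
    + rewrite -(mulr0 (2 * C)); apply: cvgMl_tmp.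
      exact: cvg_harmonic.
  rewrite -(cvg_lim (@Rhausdorff R) ch) -(cvg_lim (@Rhausdorff R) c0).
  by under eq_fun do rewrite hE.
have Is : P.-integrable setT (EFin \o (fun w => sin (t * Y w + a))).
  by apply: (@integrable_bounded _ _ _ _ _ 1) => //; exact: (measurableT_comp msl mY).
have IYc : P.-integrable setT (EFin \o (fun w => (Y w - m) * cos (t * Y w + a))).
  have Im : P.-integrable setT (EFin \o cst (`|m|)).
    by apply: (@integrable_bounded _ _ _ _ _ `|(`|m|)|).
  apply: (@integrable_dominated _ _ _ _ _ (fun w => `|Y w| + `|m|)).
  - apply: measurable_funM; first exact: measurable_funB.
    exact: (measurableT_comp mcl mY).
  - move=> w; rewrite normrM; apply: (@le_trans _ _ (`|Y w - m|)).
      by rewrite ler_piMr.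
    exact: ler_normB.
  - exact: (integrableD measurableT (integrable_norm IY) Im).
have Is' := integrableZl measurableT (- t) Is.
have IYc' := integrableZl measurableT ((s ^+ 2)^-1) IYc.
have : \int[P]_w g (Y w) = \int[P]_w (- t * sin (t * Y w + a) -
    (s ^+ 2)^-1 * ((Y w - m) * cos (t * Y w + a))).
  by apply: eq_Rintegral => w _; rewrite /g; field; exact: sN0.
rewrite E0 RintegralB// !RintegralZl// => /esym /eqP; rewrite subr_eq0 => /eqP E.
have s2N0 : s ^+ 2 != 0 by rewrite expf_neq0.
rewrite -[LHS](mulVKf s2N0) -E; ring.
Unshelve. all: by end_near.
Qed.

Hypothesis EY : \int[P]_w Y w = 0.

(** Stein's identity at [t = 0] with phase 0 says that [Y - m] has expectation zero. *)
Lemma normal_mean0 : m = 0.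
Proof.
have := stein_cos 0 0; rewrite mulr0 mul0r.
rewrite (@eq_Rintegral _ _ _ P setT (fun w => Y w - cst m w)); last first.
  by move=> w _; rewrite mul0r addr0 cos0 mulr1.
rewrite RintegralB//; last first.
  by apply: (@integrable_bounded _ _ _ _ _ `|m|).
by rewrite EY Rintegral_cstT sub0r => /eqP; rewrite oppr_eq0 => /eqP.
Qed.

(** Differentiation under the integral, dominated by [|Y|], produces [- Y * sin (t * Y + a)]. This
    is [Y] times the cosine with phase [a + pi / 2], so Stein's identity at that phase returns the
    original cosine. *)
Lemma is_derive_Rintegral_cos a (t : R) :
  is_derive t (1 : R) (fun t => \int[P]_w cos (t * Y w + a))
    (- s ^+ 2 * t * \int[P]_w cos (t * Y w + a)).
Proof.
pose f (t : R) w := cos (t * Y w + a).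
have df x w : is_derive x (1 : R) (f ^~ w) (- Y w * sin (x * Y w + a)).
  by rewrite /f; apply: is_derive_eq; rewrite /GRing.scale /=; ring.
have mtY (x : R) : measurable_fun setT (fun w => x * Y w + a).
  by apply: measurable_funD => //; exact: measurable_funM.
have If : forall x : R, t - 1 < x < t + 1 -> P.-integrable setT (EFin \o f x).
  move=> x _; apply: (@integrable_bounded _ _ _ _ _ 1).
    exact: (measurableT_comp mcos (mtY x)).
  by move=> w; exact: cos1.
have tI : t \in `]t - 1, t + 1[%R by rewrite in_itv /=; apply/andP; split; lra.
have pE : forall (u : R) (w : T), partial1of2 f u w = - Y w * sin (u * Y w + a).
  by move=> u w; rewrite partial1of2E derive_val.
have dub : forall (u : R) (w : T), `]t - 1, t + 1[%classic u -> setT w ->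
    `|partial1of2 f u w| <= `|Y w|.
  by move=> u w _ _; rewrite pE normrM normrN ler_piMr.
have dI : forall (u : R) (w : T), `]t - 1, t + 1[%classic u -> setT w ->
    derivable (f ^~ w) u 1.
  by move=> u w _ _; exact: ex_derive.
have If' : forall u : R, `]t - 1, t + 1[%classic u -> P.-integrable setT (EFin \o f u).
  by move=> u /=; rewrite in_itv; exact: If.
have IY' := integrable_norm IY.
apply: DeriveDef.
  exact: (derivable_under_integral measurableT tI If' dI
    (fun=> normr_ge0 _) IY' dub).
rewrite -derive1E (differentiation_under_integral measurableT tI If' dI
    (fun=> normr_ge0 _) IY' dub).
have := stein_cos t (a + pi / 2); rewrite normal_mean0.
rewrite (@eq_Rintegral _ _ _ P setT (fun w => partial1of2 f t w)); last first.
  by move=> w _; rewrite pE subr0 addrA cosDpihalf; ring.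
move=> ->; congr (_ * _); apply: eq_Rintegral => w _.
by rewrite addrA sinDpihalf.
Qed.

(** The integrating factor [expR (s ^+ 2 * t ^+ 2 / 2)] turns the differential equation into
    constancy of [psi], whose value at 0 is [cos a]. *)
Lemma Rintegral_cos_normal a t :
  \int[P]_w cos (t * Y w + a) = cos a * expR (- (s ^+ 2 * t ^+ 2 / 2)).
Proof.
pose psi (t : R) := (\int[P]_w cos (t * Y w + a)) * expR (s ^+ 2 * t ^+ 2 / 2).
have dpsi (x : R) : is_derive x (1 : R) psi 0.
  have d1 := is_derive_Rintegral_cos a x.
  rewrite /psi; apply: is_derive_eq.
  by rewrite /GRing.scale /=; field.
have : psi t = psi 0 by exact: is_derive_0_is_cst.
rewrite /psi expr0n /= mulr0 mul0r expR0 mulr1.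
under [X in _ = X]eq_Rintegral do rewrite mul0r add0r.
by rewrite Rintegral_cstT => <-; rewrite -[RHS]mulrA expRxMexpNx_1 mulr1.
Qed.

(** This ties the parameter [s] to the covariance matrix. Stein's identity with phase [- (pi / 2)]
    evaluates the expectation of [Y * sin (t * Y)] as [s ^+ 2 * t * expR (- (s ^+ 2 * t ^+ 2 / 2))];
    dividing by [t = 1 / n.+1] and letting [n] grow gives the second moment. *)
Lemma normal_variance : P.-integrable setT (EFin \o (fun w => Y w ^+ 2)) ->
  \int[P]_w Y w ^+ 2 = s ^+ 2.
Proof.
move=> IY2.
have c1 : \int[P]_w (Y w * (n.+1%:R * sin (n.+1%:R^-1 * Y w))) @[n --> \oo] -->
    \int[P]_w Y w ^+ 2.
  apply: (@Rintegral_lim _ _ _ P _ _ (fun w => Y w ^+ 2)) => //.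
  - move=> n; apply: measurable_funM => //; apply: measurable_funM => //.
    by apply: measurableT_comp => //; exact: measurable_funM.
  - by move=> w; rewrite expr2; apply: cvgMl_tmp; exact: cvg_natM_sin.
  - move=> n w; rewrite normrM -[leRHS]real_normK ?num_real// expr2 ler_wpM2l//.
    exact: norm_natM_sin.
have E n : \int[P]_w (Y w * (n.+1%:R * sin (n.+1%:R^-1 * Y w))) =
    s ^+ 2 * expR (- (s ^+ 2 * (n.+1%:R^-1) ^+ 2 / 2)).
  have n0 : (n.+1%:R : R) != 0 by rewrite pnatr_eq0.
  have := stein_cos n.+1%:R^-1 (- (pi / 2)); rewrite normal_mean0.
  under eq_Rintegral do rewrite subr0 cosBpihalf.
  (* [- cos x] is rewritten as [cos (x + pi)] to match the closed form at phase [pi]. *)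
  under [X in _ = _ * X]eq_Rintegral do
    rewrite sinBpihalf -cosDpi -[_ + pi]addr0 -addrA addr0.
  rewrite Rintegral_cos_normal cospi => h.
  rewrite (@eq_Rintegral _ _ _ P setT
    (fun w => n.+1%:R * (Y w * sin (n.+1%:R^-1 * Y w)))); last first.
    by move=> w _; rewrite mulrCA.
  rewrite RintegralZl// ?h.
    by move: (expR _) => e; move: (n.+1%:R : R) n0 => k k0; field.
  apply: (@integrable_dominated _ _ _ _ _ (fun w => `|Y w|)).
  - apply: measurable_funM => //.
    by apply: measurableT_comp => //; exact: measurable_funM.
  - by move=> w; rewrite normrM ler_piMr.
  - exact: (integrable_norm IY).
rewrite -(cvg_lim (@Rhausdorff R) c1).
under eq_fun do rewrite E.
apply: (cvg_lim (@Rhausdorff R)).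
have h : - (s ^+ 2 * n.+1%:R^-1 ^+ 2 / 2) @[n --> \oo] -->
    - (s ^+ 2 * (0 : R) ^+ 2 / 2).
  by apply: cvgN; apply: cvgMr_tmp; apply: cvgMl_tmp; apply: cvgM;
    exact: cvg_harmonic.
have h' : s ^+ 2 * expR (- (s ^+ 2 * n.+1%:R^-1 ^+ 2 / 2)) @[n --> \oo] -->
    s ^+ 2 * expR (- (s ^+ 2 * (0 : R) ^+ 2 / 2)).
  apply: cvgMl_tmp; apply: (cvg_comp _ expR h); exact: continuous_expR.
by move: h'; rewrite expr0n /= mulr0 mul0r oppr0 expR0 mulr1.
Qed.

End gaussian_cos.

(** * Trigonometric approximation *)

Section trigonometric_polynomials.
Context (R : realType) (d : nat).
Implicit Types (x y z u : 'rV[R]_d).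

(** The real span of cosines of affine forms. Products are not a constructor: the product-to-sum
    formula gives them, so that convergence of expectations need only be checked on single
    cosines. *)
Inductive trigpoly : ('rV[R]_d -> R) -> Prop :=
| trigpoly_cos u a : trigpoly (fun x => cos (a + \sum_(j < d) u ord0 j * x ord0 j))
| trigpoly_add g h : trigpoly g -> trigpoly h -> trigpoly (fun x => g x + h x)
| trigpoly_scale c g : trigpoly g -> trigpoly (fun x => c * g x).

Lemma trigpoly_cst c : trigpoly (fun=> c).
Proof.
have := trigpoly_scale c (trigpoly_cos 0 0).
congr trigpoly; apply/funext => x.
rewrite big1 ?addr0 ?cos0 ?mulr1// => j _.
by rewrite mxE mul0r.
Qed.

Lemma trigpoly_mul g h : trigpoly g -> trigpoly h ->
  trigpoly (fun x => g x * h x).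
Proof.
elim=> [u a|g1 g2 _ IH1 _ IH2|c g1 _ IH] th.
- elim: th => [v b|h1 h2 _ IH1 _ IH2|c h1 _ IH].
  + have h1 := trigpoly_scale 2^-1 (trigpoly_cos (u + v) (a + b)).
    have h2 := trigpoly_scale 2^-1 (trigpoly_cos (u - v) (a - b)).
    have := trigpoly_add h1 h2; congr trigpoly; apply/funext => x.
    set A := \sum_(j < d) u ord0 j * x ord0 j.
    set B := \sum_(j < d) v ord0 j * x ord0 j.
    have -> : \sum_(j < d) (u + v) ord0 j * x ord0 j = A + B.
      by rewrite -big_split; apply: eq_bigr => j _; rewrite mxE mulrDl.
    have -> : \sum_(j < d) (u - v) ord0 j * x ord0 j = A - B.
      by rewrite -sumrB; apply: eq_bigr => j _; rewrite !mxE mulrBl.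
    have -> : a + b + (A + B) = (a + A) + (b + B) by ring.
    have -> : a - b + (A - B) = (a + A) - (b + B) by ring.
    by rewrite cosB cosD; field.
  + have := trigpoly_add IH1 IH2; congr trigpoly.
    by apply/funext => x; rewrite mulrDr.
  + have := trigpoly_scale c IH; congr trigpoly.
    by apply/funext => x; rewrite mulrCA.
- have := trigpoly_add (IH1 th) (IH2 th); congr trigpoly.
  by apply/funext => x; rewrite mulrDl.
- have := trigpoly_scale c (IH th); congr trigpoly.
  by apply/funext => x; rewrite mulrA.
Qed.

Lemma trigpoly_sin_coord (j : 'I_d) (c : R) : trigpoly (fun x => sin (c * x ord0 j)).
Proof.
have := trigpoly_cos (c *: delta_mx ord0 j) (- (pi / 2)).
congr trigpoly; apply/funext => x.
rewrite addrC cosBpihalf (bigD1 j)//= big1 ?addr0 => [|i ij].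
  by rewrite !mxE !eqxx mulr1.
by rewrite !mxE eqxx (negbTE ij) mulr0 mul0r.
Qed.

(* The expectation of [h] at the endpoint of a walk started at [y] with steps
   [+/- delta] along the successive coordinates in [s], a step along [j] having
   mean [delta * m j]: a version of the Bernstein operator which is a
   trigonometric polynomial when [m] consists of sines. *)
Fixpoint walk (m : 'I_d -> R) (delta : R) (s : seq 'I_d) (h : 'rV[R]_d -> R) y :=
  if s is j :: s' then
    (1 + m j) / 2 * walk m delta s' h (y + delta *: delta_mx ord0 j) +
    (1 - m j) / 2 * walk m delta s' h (y - delta *: delta_mx ord0 j)
  else h y.

Lemma trigpoly_walk (c delta : R) s h y :
  trigpoly (fun x => walk (fun j => sin (c * x ord0 j)) delta s h y).
Proof.
elim: s y => [|j s IH] y /=; first exact: trigpoly_cst.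
have ts := trigpoly_sin_coord j c.
apply: trigpoly_add; apply: trigpoly_mul => //.
  have := trigpoly_scale 2^-1 (trigpoly_add (trigpoly_cst 1) ts).
  by congr trigpoly; apply/funext => x; rewrite mulrC.
have := trigpoly_scale 2^-1 (trigpoly_add (trigpoly_cst 1) (trigpoly_scale (-1) ts)).
by congr trigpoly; apply/funext => x; rewrite mulN1r mulrC.
Qed.

Section walk_theory.
Variables (m : 'I_d -> R) (delta : R).

Lemma walk_cst s c y : walk m delta s (fun=> c) y = c.
Proof. by elim: s y => [|j s IH] y //=; rewrite !IH; field. Qed.

Lemma walk_add s g h y : walk m delta s (fun z => g z + h z) y =
  walk m delta s g y + walk m delta s h y.
Proof. by elim: s y => [|j s IH] y //=; rewrite !IH; ring. Qed.

Lemma walk_scale s c h y : walk m delta s (fun z => c * h z) y =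
  c * walk m delta s h y.
Proof. by elim: s y => [|j s IH] y //=; rewrite !IH; ring. Qed.

Lemma walk_sum s (I : Type) (r : seq I) (h : I -> 'rV[R]_d -> R) y :
  walk m delta s (fun z => \sum_(i <- r) h i z) y =
  \sum_(i <- r) walk m delta s (h i) y.
Proof.
elim: r => [|i r IH].
  by rewrite big_nil (_ : (fun _ => _) = fun=> 0) ?walk_cst//;
    apply/funext => z; rewrite big_nil.
rewrite big_cons -IH -walk_add; congr walk; apply/funext => z.
by rewrite big_cons.
Qed.

Lemma walk_le s g h y : (forall j, -1 <= m j <= 1) ->
  (forall z, g z <= h z) -> walk m delta s g y <= walk m delta s h y.
Proof.
move=> m1 gh; elim: s y => [|j s IH] y //=.
by have /andP[h1 h2] := m1 j; apply: lerD; apply: ler_wpM2l => //; lra.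
Qed.

(** Variance plus squared bias: steps along [j] are independent with mean [delta * m j] and variance
    [(1 - m j ^+ 2) * delta ^+ 2], and the other steps leave this coordinate fixed. *)
Lemma walk_sqr s j (c : R) y :
  walk m delta s (fun z => (z ord0 j - c) ^+ 2) y =
  (count_mem j s)%:R * ((1 - m j ^+ 2) * delta ^+ 2) +
  (y ord0 j + (count_mem j s)%:R * (delta * m j) - c) ^+ 2.
Proof.
elim: s y => [|i s IH] y /=; first by rewrite !mul0r addr0 add0r.
rewrite !IH !mxE eqxx /= eq_sym natrD; case: eqVneq => [->|ij] /=.
  by rewrite mulr1; field.
by rewrite mulr0; field.
Qed.

End walk_theory.

Lemma count_mem_enum_nseq N (j : 'I_d) :
  count_mem j (flatten (nseq N (enum 'I_d))) = N.
Proof.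
rewrite count_flatten map_nseq sumn_nseq count_uniq_mem ?enum_uniq//.
by rewrite mem_enum inE mul1n.
Qed.

(** The point [x] is first replaced by [b], with coordinates [L * sin (x_j / L)]; this moves each
    coordinate by at most [x_j ^+ 2 / L], the source of the quadratic weight. Then [f b] is replaced
    by the mean of [f] at [L] times the endpoint of a walk from 0 with [N] steps of size [1 / N] in
    each coordinate, whose mean endpoint is [b / L] and whose variance is at most [1 / N] per
    coordinate. *)
Lemma trigpoly_approx (f : 'rV[R]_d -> R) (e : R) :
  (exists M : R, forall x, `|f x| <= M) -> unif_continuous f -> 0 < e ->
  exists2 g, trigpoly g &
    forall x, `|f x - g x| <= e * (1 + \sum_(j < d) x ord0 j ^+ 2).
Proof.
move=> [B0 fB0] /unif_continuousP uf e0.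
(* A strictly positive bound, so that [L] below is positive. *)
pose B : R := B0 + 1.
have fB x : `|f x| <= B by apply: le_trans (fB0 x) _; rewrite /B lerDl.
have B_gt0 : 0 < B.
  by rewrite /B; have := le_trans (normr_ge0 _) (fB0 0); lra.
pose e' := e / 3; have e'0 : 0 < e' by rewrite /e'; lra.
have [eta eta0 Heta] := uf e' e'0.
have close (a b : 'rV[R]_d) : (forall j, `|a ord0 j - b ord0 j| < eta) -> `|f a - f b| <= e'.
  move=> ab; have /= := Heta (a, b).
  rewrite /ball /= => h; apply/ltW/h; split=> // i j.
  by rewrite (ord1 i); exact: ab.
have far (a b : 'rV[R]_d) : `|f a - f b| <= 2 * B.
  by apply: le_trans (ler_normB _ _) _; rewrite mulr_natl mulr2n lerD.
(* When some coordinates differ by at least [eta], the sum term alone reaches the trivial bound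
   [2 * B]. The linear form serves the move from [x] to [b], the quadratic form [mod2] the variance
   of the walk. *)
have mod1 (a b : 'rV[R]_d) : `|f a - f b| <=
    e' + 2 * B / eta * \sum_(j < d) `|a ord0 j - b ord0 j|.
  have S0 : 0 <= \sum_(j < d) `|a ord0 j - b ord0 j| by exact: sumr_ge0.
  have [/forallP h|] := boolP [forall j, `|a ord0 j - b ord0 j| < eta].
    apply: le_trans (close _ _ h) _.
    by rewrite lerDl mulr_ge0// divr_ge0// ltW// mulr_gt0.
  rewrite negb_forall => /existsP[j]; rewrite -leNgt => hj.
  apply: le_trans (far _ _) _; apply: ler_wpDl; first exact: ltW.
  rewrite -mulrA ler_peMr//; first by rewrite mulr_ge0// ltW.
  rewrite ler_pdivlMl// mulr1 (bigD1 j)//=.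
  by apply: le_trans hj _; rewrite lerDl sumr_ge0.
have mod2 (a b : 'rV[R]_d) : `|f a - f b| <=
    e' + 2 * B / eta ^+ 2 * \sum_(j < d) (a ord0 j - b ord0 j) ^+ 2.
  have S0 : 0 <= \sum_(j < d) (a ord0 j - b ord0 j) ^+ 2.
    by apply: sumr_ge0 => j _; exact: sqr_ge0.
  have [/forallP h|] := boolP [forall j, `|a ord0 j - b ord0 j| < eta].
    apply: le_trans (close _ _ h) _.
    by rewrite lerDl mulr_ge0// divr_ge0 ?sqr_ge0// ltW// mulr_gt0.
  rewrite negb_forall => /existsP[j]; rewrite -leNgt => hj.
  apply: le_trans (far _ _) _; apply: ler_wpDl; first exact: ltW.
  rewrite -mulrA ler_peMr//; first by rewrite mulr_ge0// ltW.
  rewrite ler_pdivlMl ?exprn_gt0// mulr1 (bigD1 j)//=.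
  apply: (@le_trans _ _ ((a ord0 j - b ord0 j) ^+ 2)).
    rewrite -[leRHS]real_normK ?num_real//.
    by rewrite lerXn2r ?nnegrE// ltW.
  by rewrite lerDl sumr_ge0// => i _; exact: sqr_ge0.
(* Chosen so that the slope in [mod1] divided by [L] is exactly [e']. *)
pose L := 2 * B / (eta * e').
have L0 : 0 < L by rewrite !(divr_gt0, mulr_gt0).
pose K := 2 * B / eta ^+ 2 * L ^+ 2.
have K0 : 0 <= K.
  by rewrite mulr_ge0 ?sqr_ge0// divr_ge0 ?sqr_ge0// mulr_ge0// ltW.
(* Enough steps for the total variance [d / N], times [K], to be at most [e']. *)
pose N := (Num.trunc (K * d%:R / e')).+1.
have N0 : (0 : R) < N%:R by rewrite ltr0n.
have KN : K * d%:R / N%:R <= e'.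
  rewrite ler_pdivrMr// [leRHS]mulrC -ler_pdivrMr//; apply/ltW; exact: truncnS_gt.
pose s := flatten (nseq N (enum 'I_d)).
pose h (z : 'rV[R]_d) := f (L *: z).
pose mu (x : 'rV[R]_d) j := sin (L^-1 * x ord0 j).
pose g x := walk (mu x) N%:R^-1 s h 0.
exists g; first exact: trigpoly_walk.
move=> x.
have mu1 j : -1 <= mu x j <= 1 by rewrite sin_geN1 sin_le1.
pose b : 'rV[R]_d := \row_j (L * mu x j).
have h_b z : `|h z - f b| <= e' + K * \sum_(j < d) (z ord0 j - mu x j) ^+ 2.
  apply: le_trans (mod2 _ _) _; rewrite lerD2l.
  rewrite (_ : \sum_(j < d) _ = L ^+ 2 * \sum_(j < d) (z ord0 j - mu x j) ^+ 2).
    by rewrite mulrA.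
  by rewrite mulr_sumr; apply: eq_bigr => j _; rewrite !mxE; ring.
pose V (z : 'rV[R]_d) := e' + K * \sum_(j < d) (z ord0 j - mu x j) ^+ 2.
(* As [mu x] is the mean endpoint, [walk_sqr] has no bias term here and only the variance
   remains. *)
have WV : walk (mu x) N%:R^-1 s V 0 <= e' + e'.
  rewrite walk_add walk_cst walk_scale walk_sum lerD2l.
  apply: le_trans KN; rewrite -mulrA; apply: ler_wpM2l => //.
  rewrite (_ : d%:R / N%:R = \sum_(j < d) (N%:R : R)^-1); last first.
    by rewrite sumr_const card_ord mulr_natl.
  apply: ler_sum => j _; rewrite walk_sqr count_mem_enum_nseq mxE add0r.
  rewrite (_ : _ + _ = (1 - mu x j ^+ 2) * N%:R^-1); last first.
    by move: (N%:R : R) N0 => k k0; field; rewrite gt_eqF.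
  by rewrite ler_piMl ?invr_ge0 ?(ltW N0)// lerBlDr lerDl sqr_ge0.
have g_b : `|g x - f b| <= e' + e'.
  rewrite ler_norml; apply/andP; split.
    have : walk (mu x) N%:R^-1 s (fun z => f b + (-1) * V z) 0 <= g x.
      apply: walk_le => // z; have := h_b z; rewrite ler_norml => /andP[h1 _].
      by rewrite /V; lra.
    by rewrite walk_add walk_cst walk_scale; lra.
  have : g x <= walk (mu x) N%:R^-1 s (fun z => f b + V z) 0.
    apply: walk_le => // z; have := h_b z; rewrite ler_norml => /andP[_ h1].
    by rewrite /V; lra.
  by rewrite walk_add walk_cst; lra.
have x_b : `|f x - f b| <= e' + e' * \sum_(j < d) x ord0 j ^+ 2.
  apply: le_trans (mod1 _ _) _; rewrite lerD2l.
  apply: (@le_trans _ _ (2 * B / eta * \sum_(j < d) (L^-1 * x ord0 j ^+ 2))).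
    apply: ler_wpM2l; first by rewrite divr_ge0 ?mulr_ge0// ltW.
    apply: ler_sum => j _; rewrite mxE.
    rewrite (_ : _ - _ = L * (L^-1 * x ord0 j - mu x j)); last first.
      by rewrite mulrBr mulVKf ?gt_eqF.
    rewrite normrM (ger0_norm (ltW L0)) -ler_pdivlMl//.
    rewrite (_ : _ * (_ * _) = (L^-1 * x ord0 j) ^+ 2); last by ring.
    exact: (sin_rem _).1.
  rewrite -mulr_sumr mulrA (_ : 2 * B / eta / L = e')//.
  by rewrite /L; field; rewrite !gt_eqF.
have -> : f x - g x = (f x - f b) - (g x - f b) by ring.
apply: le_trans (ler_normB _ _) _.
have S0 : 0 <= \sum_(j < d) x ord0 j ^+ 2.
  by apply: sumr_ge0 => j _; exact: sqr_ge0.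
have -> : e = 3 * e' by rewrite /e'; field.
have := mulr_ge0 (ltW e'0) S0; lra.
Qed.

End trigonometric_polynomials.

(** * Random vectors *)

Section random_vector.
Context dT (T : measurableType dT) (R : realType) (P : probability T R) (d : nat).

Lemma Rintegral_sum (I : Type) (r : seq I) (h : I -> T -> R) :
  (forall i, P.-integrable setT (EFin \o h i)) ->
  P.-integrable setT (EFin \o (fun w => \sum_(i <- r) h i w)) /\
  \int[P]_w (\sum_(i <- r) h i w) = \sum_(i <- r) \int[P]_w h i w.
Proof.
move=> Ih; elim: r => [|i r [IH1 IH2]].
  have -> : (fun w => \sum_(i <- [::]) h i w) = fun=> 0.
    by apply/funext => w; rewrite big_nil.
  split; last by rewrite Rintegral_cstT big_nil.
  by apply: (@integrable_bounded _ _ _ _ _ 0) => // w; rewrite normr0.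
have -> : (fun w => \sum_(i <- i :: r) h i w) =
    fun w => h i w + \sum_(i <- r) h i w.
  by apply/funext => w; rewrite big_cons.
split; first exact: (integrableD measurableT (Ih i) IH1).
by rewrite RintegralD// big_cons IH2.
Qed.

Implicit Types (Y : T -> 'rV[R]_d) (u x : 'rV[R]_d).

Lemma measurable_lincomb Y a u :
  (forall j, measurable_fun setT (coordinate Y j)) ->
  measurable_fun setT (fun w => a + \sum_(j < d) u ord0 j * Y w ord0 j).
Proof.
move=> mY; apply: measurable_funD => //.
by apply: measurable_sum => j; apply: measurable_funM => //; exact: mY.
Qed.

Lemma measurable_trigpoly Y g : (forall j, measurable_fun setT (coordinate Y j)) ->
  trigpoly g -> measurable_fun setT (g \o Y).
Proof.
move=> mY; elim=> [u a|g1 g2 _ IH1 _ IH2|c g1 _ IH].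
- apply: (measurableT_comp (f := @cos R)); last exact: measurable_lincomb.
  by apply: continuous_measurable_fun; exact: continuous_cos.
- exact: measurable_funD.
- exact: measurable_funM.
Qed.

Lemma trigpoly_bounded (g : 'rV[R]_d -> R) : trigpoly g ->
  exists M : R, forall x, `|g x| <= M.
Proof.
elim=> [u a|g1 g2 _ [M1 H1] _ [M2 H2]|c g1 _ [M1 H1]].
- by exists 1 => x; rewrite ler_norml cos_geN1 cos_le1.
- by exists (M1 + M2) => x; apply: le_trans (ler_normD _ _) (lerD _ _).
- by exists (`|c| * M1) => x; rewrite normrM ler_wpM2l.
Qed.

Lemma integrable_trigpoly Y g : (forall j, measurable_fun setT (coordinate Y j)) ->
  trigpoly g -> P.-integrable setT (EFin \o (fun w => g (Y w))).
Proof.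
move=> mY tg; have [M gM] := trigpoly_bounded tg.
by apply: (@integrable_bounded _ _ _ _ _ M) => //; exact: measurable_trigpoly.
Qed.

(* f is a pointwise limit of trigonometric polynomials, so no joint
   measurability of the coordinates is needed. *)
Lemma measurable_unif_continuous Y (f : 'rV[R]_d -> R) :
  (forall j, measurable_fun setT (coordinate Y j)) ->
  (exists M : R, forall x, `|f x| <= M) -> unif_continuous f ->
  measurable_fun setT (fun w => f (Y w)).
Proof.
move=> mY fb uf.
have /choice[g Hg] : forall n : nat, exists g, trigpoly g /\
    forall x, `|f x - g x| <= n.+1%:R^-1 * (1 + \sum_(j < d) x ord0 j ^+ 2).
  move=> n; have n0 : 0 < (n.+1%:R^-1 : R) by rewrite invr_gt0.
  by have [g tg gf] := trigpoly_approx fb uf n0; exists g.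
apply: (@measurable_fun_cvg _ _ _ _ (fun n => g n \o Y)).
  by move=> n; apply: measurable_trigpoly => //; exact: (Hg n).1.
move=> w _; apply/subr_cvg0; apply: norm_cvg0.
pose K := 1 + \sum_(j < d) Y w ord0 j ^+ 2.
apply: (@squeeze_cvgr _ _ _ _ (cst 0) (fun n => n.+1%:R^-1 * K)).
- by apply: nearW => n; rewrite normr_ge0 /= distrC; exact: (Hg n).2.
- exact: cvg_cst.
- by rewrite -(mul0r K); apply: cvgMr_tmp; exact: cvg_harmonic.
Qed.

Lemma Rintegral_approx Y (f g : 'rV[R]_d -> R) (e : R) (v : 'I_d -> R) :
  (forall j, measurable_fun setT (coordinate Y j)) ->
  (forall j, P.-integrable setT (EFin \o (fun w => Y w ord0 j ^+ 2)) /\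
    \int[P]_w Y w ord0 j ^+ 2 <= v j) ->
  P.-integrable setT (EFin \o (fun w => f (Y w))) -> trigpoly g -> 0 <= e ->
  (forall x, `|f x - g x| <= e * (1 + \sum_(j < d) x ord0 j ^+ 2)) ->
  `|\int[P]_w f (Y w) - \int[P]_w g (Y w)| <= e * (1 + \sum_(j < d) v j).
Proof.
move=> mY IY If tg e0 fg.
have Ig := integrable_trigpoly mY tg.
rewrite -(RintegralB measurableT If Ig).
have Ifg := integrableB measurableT If Ig.
apply: le_trans (le_normr_Rintegral measurableT Ifg) _.
have [IS ES] := Rintegral_sum (index_enum 'I_d) (fun j => (IY j).1).
have I1 : P.-integrable setT (EFin \o cst (1 : R)).
  by apply: (@integrable_bounded _ _ _ _ _ 1) => // w; rewrite normr1.
have I1S := integrableD measurableT I1 IS.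
have IeS := integrableZl measurableT e I1S.
apply: (@le_trans _ _ (\int[P]_w (e * (1 + \sum_(j < d) Y w ord0 j ^+ 2)))).
  by apply: le_Rintegral => //; exact: (integrable_norm Ifg).
rewrite (RintegralZl e measurableT I1S) (RintegralD measurableT I1 IS).
rewrite Rintegral_cstT ES.
by rewrite ler_wpM2l// lerD2l ler_sum// => j _; exact: (IY j).2.
Qed.

End random_vector.

(** * From convergence of cosine expectations to weak convergence *)

(** The common bound [v] on second moments makes the cost of replacing [f] by a trigonometric
    polynomial uniform in [n]. That replacement takes one third of [e] on each side, and convergence
    for the polynomial takes the last third. *)
Lemma cvg_Rintegral_of_cos dT (T : measurableType dT) dT' (T' : measurableType dT')
    (R : realType) (P : probability T R) (Q : probability T' R) (d : nat)
    (Y : nat -> T -> 'rV[R]_d) (Z : T' -> 'rV[R]_d) (v : 'I_d -> R)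
    (f : 'rV[R]_d -> R) :
  (forall n j, measurable_fun setT (coordinate (Y n) j)) ->
  (forall j, measurable_fun setT (coordinate Z j)) ->
  (forall n j, P.-integrable setT (EFin \o (fun w => Y n w ord0 j ^+ 2)) /\
    \int[P]_w Y n w ord0 j ^+ 2 <= v j) ->
  (forall j, Q.-integrable setT (EFin \o (fun w => Z w ord0 j ^+ 2)) /\
    \int[Q]_w Z w ord0 j ^+ 2 <= v j) ->
  (forall (u : 'rV[R]_d) (a : R), \int[P]_w cos (a + \sum_(j < d) u ord0 j * Y n w ord0 j)
    @[n --> \oo] --> \int[Q]_w cos (a + \sum_(j < d) u ord0 j * Z w ord0 j)) ->
  (exists M : R, forall x, `|f x| <= M) -> unif_continuous f ->
  \int[P]_w f (Y n w) @[n --> \oo] --> \int[Q]_w f (Z w).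
Proof.
move=> mY mZ IY IZ Hcos fb uf.
have Hg g : trigpoly g -> \int[P]_w g (Y n w) @[n --> \oo] --> \int[Q]_w g (Z w).
  elim=> [u a|g1 g2 t1 IH1 t2 IH2|c g1 t1 IH]; first exact: Hcos.
  - rewrite (RintegralD measurableT (integrable_trigpoly Q mZ t1)
      (integrable_trigpoly Q mZ t2)).
    under eq_fun => n do rewrite (RintegralD measurableT
      (integrable_trigpoly P (mY n) t1) (integrable_trigpoly P (mY n) t2)).
    exact: cvgD.
  - rewrite (RintegralZl c measurableT (integrable_trigpoly Q mZ t1)).
    under eq_fun => n do
      rewrite (RintegralZl c measurableT (integrable_trigpoly P (mY n) t1)).
    exact: cvgMl_tmp.
have v0 : 0 <= \sum_(j < d) v j.
  apply: sumr_ge0 => j _; apply: le_trans (IZ j).2.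
  by apply: Rintegral_ge0 => w _; exact: sqr_ge0.
have [M fM] := fb.
have IfY n : P.-integrable setT (EFin \o (fun w => f (Y n w))).
  apply: (@integrable_bounded _ _ _ _ _ M) => //.
  exact: measurable_unif_continuous.
have IfZ : Q.-integrable setT (EFin \o (fun w => f (Z w))).
  apply: (@integrable_bounded _ _ _ _ _ M) => //.
  exact: measurable_unif_continuous.
apply/cvgrPdist_le => e e0.
pose e1 := e / 3 / (1 + \sum_(j < d) v j).
have V0 : 0 < 1 + \sum_(j < d) v j by rewrite ltr_pwDl.
have e10 : 0 < e1 by rewrite !divr_gt0.
have e1V : e1 * (1 + \sum_(j < d) v j) = e / 3 by rewrite /e1 divfK// gt_eqF.
have [g tg fg] := trigpoly_approx fb uf e10.
have e3 : 0 < e / 3 by rewrite divr_gt0.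
have /cvgrPdist_le /(_ _ e3) := Hg _ tg.
apply: filterS => n hn.
have h1 := Rintegral_approx mZ IZ IfZ tg (ltW e10) fg.
have h2 := Rintegral_approx (mY n) (IY n) (IfY n) tg (ltW e10) fg.
rewrite e1V in h1 h2.
rewrite (_ : _ - _ = (\int[Q]_w f (Z w) - \int[Q]_w g (Z w)) +
   (\int[Q]_w g (Z w) - \int[P]_w g (Y n w)) -
   (\int[P]_w f (Y n w) - \int[P]_w g (Y n w))); last by ring.
apply: le_trans (ler_normB _ _) _.
apply: le_trans (lerD (ler_normD _ _) (lexx _)) _.
rewrite (_ : e = e / 3 + e / 3 + e / 3); last by field.
by apply: lerD => //; exact: lerD.
Qed.

(** * Linear functionals of random vectors *)

Section linear_functionals.
Context (R : realType) (d : nat).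

Lemma measurable_coord (j : 'I_d) :
  measurable_fun setT (fun x : 'rV[R]_d => x ord0 j).
Proof.
apply: (measurability _ (RGenOInfty.measurableE R)) => _ [_ [a ->] <-].
rewrite setTI; apply: sub_sigma_algebra.
have /continuousP := @coord_continuous R 1 d ord0 j; apply.
exact: interval_open.
Qed.

Lemma measurable_linear (u : 'rV[R]_d) :
  measurable_fun setT (fun x : 'rV[R]_d => \sum_(j < d) u ord0 j * x ord0 j).
Proof.
by apply: measurable_sum => j; apply: measurable_funM => //; exact: measurable_coord.
Qed.

End linear_functionals.

Section vector_moments.
Context dT (T : measurableType dT) (R : realType) (P : probability T R) (d : nat).
Variables (Y : T -> 'rV[R]_d) (Sigma : 'M[R]_d).
Hypotheses (Y0 : centered P Y) (YS : has_covariance_matrix P Y Sigma).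

Lemma Rintegral_expectation (h : T -> R) : \int[P]_w h w = fine ('E_P[h])%E.
Proof. by rewrite unlock. Qed.

Lemma coordinate_sqr_integrable j :
  P.-integrable setT (EFin \o (fun w => Y w ord0 j ^+ 2)).
Proof. exact: (Lfun2_integrable_sqr (YS.1 j)). Qed.

Lemma coordinate_integrable j : P.-integrable setT (EFin \o coordinate Y j).
Proof. by apply/Lfun1_integrable; exact: (Y0 j).1. Qed.

Lemma coordinate_mul j k :
  P.-integrable setT (EFin \o (fun w => Y w ord0 j * Y w ord0 k)) /\
  \int[P]_w (Y w ord0 j * Y w ord0 k) = Sigma j k.
Proof.
have l1 := Lfun2_mul_Lfun1 (YS.1 j) (YS.1 k).
split; first exact/Lfun1_integrable.
rewrite Rintegral_expectation.
have := YS.2 j k; rewrite covarianceE ?(Y0 _).1//.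
by rewrite (Y0 j).2 (Y0 k).2 mule0 sube0 => ->.
Qed.

Lemma lincomb_moments (u : 'rV[R]_d) :
  let U w := \sum_(j < d) u ord0 j * Y w ord0 j in
  [/\ P.-integrable setT (EFin \o U), \int[P]_w U w = 0,
      P.-integrable setT (EFin \o (fun w => U w ^+ 2)) &
      \int[P]_w U w ^+ 2 =
        \sum_(j < d) \sum_(k < d) u ord0 j * u ord0 k * Sigma j k].
Proof.
move=> U.
have I1 j : P.-integrable setT (EFin \o (fun w => u ord0 j * Y w ord0 j)).
  exact: (integrableZl measurableT _ (coordinate_integrable j)).
have [IU EU] := Rintegral_sum (index_enum 'I_d) I1.
have I2 j k : P.-integrable setT
    (EFin \o (fun w => u ord0 j * u ord0 k * (Y w ord0 j * Y w ord0 k))).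
  exact: (integrableZl measurableT _ (coordinate_mul j k).1).
have I3 j := Rintegral_sum (index_enum 'I_d) (I2 j).
have [I4 E4] := Rintegral_sum (index_enum 'I_d) (fun j => (I3 j).1).
have UE : (fun w => U w ^+ 2) = (fun w => \sum_(j < d) \sum_(k < d)
    u ord0 j * u ord0 k * (Y w ord0 j * Y w ord0 k)).
  apply/funext => w; rewrite expr2 /U mulr_suml; apply: eq_bigr => j _.
  by rewrite mulr_sumr; apply: eq_bigr => k _; ring.
split => //.
- rewrite EU big1// => j _.
  rewrite (RintegralZl _ measurableT (coordinate_integrable j)).
  by rewrite Rintegral_expectation (Y0 j).2 mulr0.
- by rewrite UE.
- rewrite UE E4; apply: eq_bigr => j _.
  rewrite (I3 j).2; apply: eq_bigr => k _.
  by rewrite (RintegralZl _ measurableT (coordinate_mul j k).1) (coordinate_mul j k).2.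
Qed.

Lemma measurable_coordinate j : measurable_fun setT (coordinate Y j).
Proof. by have /integrableP[/measurable_EFinP] := coordinate_integrable j. Qed.

(** For a normal law, [normal_variance] identifies [s ^+ 2] with the quadratic form of [Sigma] at
    [u], and the closed form is read at [t = 1]. For a point mass both sides reduce to [cos a]. *)
Lemma Rintegral_cos_gaussian (u : 'rV[R]_d) a : gaussian_vector P Y ->
  \int[P]_w cos (a + \sum_(j < d) u ord0 j * Y w ord0 j) =
  cos a * expR (- ((\sum_(j < d) \sum_(k < d) u ord0 j * u ord0 k * Sigma j k) / 2)).
Proof.
move=> /(_ u); have [IU EU IU2 EU2] := lincomb_moments u.
rewrite -EU2; set U := fun w => _ in IU EU IU2 EU2 * => gU.
have mU : measurable_fun setT U by have /integrableP[/measurable_EFinP] := IU.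
case: gU => [[m Hm]|[m [s [s0 Hs]]]]; last first.
  rewrite (normal_variance mU s0 Hs IU EU IU2).
  have := Rintegral_cos_normal mU s0 Hs IU EU a 1.
  rewrite expr1n mulr1 => <-; apply: eq_Rintegral => w _.
  by rewrite mul1r addrC.
have E (g : R -> R) : measurable_fun setT g ->
    P.-integrable setT (EFin \o (fun w => g (U w))) -> \int[P]_w g (U w) = g m.
  move=> mg Ig.
  have mEg : measurable_fun setT (fun x => (g x)%:E) by exact/measurable_EFinP.
  pose U' : {mfun T >-> R} := mfun_Sub (mem_set mU).
  have := integral_pushforward mU mEg Ig measurableT.
  rewrite /Rintegral preimage_setT => <-.
  rewrite (_ : integral _ _ _ = \int[\d_m]_x (g x)%:E)%E.
    by rewrite integral_dirac// diracT mul1e.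
  exact: (@eq_measure_integral _ _ R setT (\d_m) (pushforward P U') _ (fun A mA _ => Hm A mA)).
(* The identity as test function locates the mass at 0; the square then shows that the quadratic
   form vanishes in this direction. *)
have m0 : m = 0 by rewrite -EU (E id).
rewrite (E (fun x => x ^+ 2))// m0 expr0n mul0r oppr0 expR0 mulr1.
have mcos : measurable_fun setT (fun x : R => cos (a + x)).
  apply: (measurableT_comp (f := @cos R)); last exact: measurable_funD.
  by apply: continuous_measurable_fun; exact: continuous_cos.
rewrite (E (fun x => cos (a + x)))// ?m0 ?addr0//.
apply: (@integrable_bounded _ _ _ _ _ 1).
  exact: (measurableT_comp mcos mU).
by move=> w; rewrite ler_norml cos_geN1 cos_le1.
Qed.

End vector_moments.

Section iid_random_vectors.
Context (R : realType) (d : nat) (dT : measure_display) (T : measurableType dT)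
  (P : probability T R) (X : nat -> {RV P >-> 'rV[R]_d}).

Lemma indep_seq_of_mutually_independent (phi : 'rV[R]_d -> R) :
  measurable_fun setT phi -> mutually_independent X ->
  indep_seq P (fun i w => phi (X i w)).
Proof.
move=> mphi iX J A mA; apply: (iX J (fun i => phi @^-1` A i)) => i.
by rewrite -[X in measurable X]setTI; exact: mphi.
Qed.

Lemma Rintegral_identically_distributed (g : 'rV[R]_d -> R) (M : R) i j :
  identically_distributed X ->
  measurable_fun setT g -> (forall x, `|g x| <= M) ->
  \int[P]_w g (X i w) = \int[P]_w g (X j w).
Proof.
move=> idX mg gM.
have mEg : measurable_fun setT (fun x => (g x)%:E) by exact/measurable_EFinP.
have mX k : measurable_fun setT (X k) by exact: measurable_funPT.
have Ig k : P.-integrable setT (EFin \o (fun w => g (X k w))).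
  by apply: (@integrable_bounded _ _ _ _ _ M) => //; exact: measurableT_comp.
have E k : (\int[P]_w (g (X k w))%:E = \int[distribution P (X k)]_x (g x)%:E)%E.
  by have := integral_pushforward (mX k) mEg (Ig k) measurableT.
rewrite /Rintegral !E; congr fine.
by apply: eq_measure_integral => A mA _; exact: idX.
Qed.

End iid_random_vectors.

Unset Implicit Arguments.

Theorem theorem1p1 (R : realType) (d : nat) (hd : (1 <= d)%N)
  (dT : measure_display) (T : measurableType dT) (P : probability T R)
  (X : nat -> {RV P >-> 'rV[R]_d})
  (X_indep : mutually_independent X)
  (X_idist : identically_distributed X)
  (X_centered : forall i : nat, centered P (X i))
  (Sigma : 'M[R]_d)
  (X_cov : forall i : nat, has_covariance_matrix P (X i) Sigma)
  (Sigma_nondegenerate : Sigma \in unitmx)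
  (dT' : measure_display) (T' : measurableType dT') (Q : probability T' R)
  (xi : {RV Q >-> 'rV[R]_d})
  (xi_gaussian : gaussian_vector Q xi)
  (xi_centered : centered Q xi)
  (xi_cov : has_covariance_matrix Q xi Sigma)
  (f : 'rV[R]_d -> R)
  (f_bounded : exists M : R, forall x : 'rV[R]_d, `|f x| <= M)
  (f_unif_continuous : unif_continuous f) :
  'E_P[fun w => f ((Num.sqrt (n%:R : R))^-1 *: \sum_(i < n) X i w)]%E
    @[n --> \oo] --> 'E_Q[fun w => f (xi w)]%E.
Proof.
pose Y (n : nat) w : 'rV[R]_d := (Num.sqrt (n%:R : R))^-1 *: \sum_(i < n) X i w.
have YE n w (u : 'rV[R]_d) : \sum_(j < d) u ord0 j * Y n w ord0 j =
    (Num.sqrt (n%:R : R))^-1 * \sum_(i < n) \sum_(j < d) u ord0 j * X i w ord0 j.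
  rewrite exchange_big mulr_sumr; apply: eq_bigr => j _.
  by rewrite /Y mxE summxE mulrCA mulr_sumr.
have YjE n w j : Y n w ord0 j =
    (Num.sqrt (n%:R : R))^-1 * \sum_(i < n) X i w ord0 j.
  by rewrite /Y mxE summxE.
have mX i j := measurable_coordinate (X_centered i) j.
have mxi j := measurable_coordinate xi_centered j.
have mY n j : measurable_fun setT (coordinate (Y n) j).
  rewrite (_ : coordinate _ _ =
      fun w => (Num.sqrt (n%:R : R))^-1 * \sum_(i < n) X i w ord0 j).
    by apply: measurable_funM => //; apply: measurable_sum => i; exact: mX.
  by apply/funext => w; exact: YjE.
have IY n j : P.-integrable setT (EFin \o (fun w => Y n w ord0 j ^+ 2)) /\
    \int[P]_w Y n w ord0 j ^+ 2 <= Sigma j j.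
  have [IS ES] := @partial_sum_sqr _ _ _ P (fun i w => X i w ord0 j) (Sigma j j)
    (fun i => mX i j)
    (indep_seq_of_mutually_independent (measurable_coord j) X_indep)
    (fun i => coordinate_sqr_integrable (X_cov i) j)
    (fun i => ltac:(by rewrite Rintegral_expectation (X_centered i j).2))
    (fun i => (coordinate_mul (X_centered i) (X_cov i) j j).2) n.
  have IcS := integrableZl measurableT ((Num.sqrt (n%:R : R))^-1 ^+ 2) IS.
  have E : (fun w => Y n w ord0 j ^+ 2) = (fun w =>
      (Num.sqrt (n%:R : R))^-1 ^+ 2 * (\sum_(i < n) X i w ord0 j) ^+ 2).
    by apply/funext => w; rewrite YjE exprMn.
  rewrite E; split => //; rewrite (RintegralZl _ measurableT IS) ES.
  have S0 : 0 <= Sigma j j.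
    rewrite -(coordinate_mul (X_centered 0%N) (X_cov 0%N) j j).2.
    by apply: Rintegral_ge0 => w _; rewrite -expr2 sqr_ge0.
  (* The second moment is [Sigma j j] for positive [n] and 0 for the empty sum, hence only an
     inequality. *)
  case: n {IS ES IcS E} => [|n]; first by rewrite mul0r mulr0.
  by rewrite mulrCA mulrA sqrt_inv_sqr// mul1r.
have Ixi j : Q.-integrable setT (EFin \o (fun w => xi w ord0 j ^+ 2)) /\
    \int[Q]_w xi w ord0 j ^+ 2 <= Sigma j j.
  split; first exact: (coordinate_sqr_integrable xi_cov).
  by have [_ <-] := coordinate_mul xi_centered xi_cov j j.
(* For fixed [u] the problem is scalar: the projections of the [X i] on [u] are independent,
   identically distributed and centered, with variance the quadratic form of [Sigma] at [u], and
   [YE] commutes projection with normalization. *)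
have cosY (u : 'rV[R]_d) (a : R) :
    \int[P]_w cos (a + \sum_(j < d) u ord0 j * Y n w ord0 j) @[n --> \oo] -->
    \int[Q]_w cos (a + \sum_(j < d) u ord0 j * xi w ord0 j).
  rewrite (Rintegral_cos_gaussian xi_centered xi_cov)//.
  under eq_fun => n do under eq_Rintegral do rewrite YE.
  have mom i := lincomb_moments (X_centered i) (X_cov i) u.
  apply: (@cvg_Rintegral_cos_sum _ _ _ P
    (fun i w => \sum_(j < d) u ord0 j * X i w ord0 j)).
  - move=> i; have [IU _ _ _] := mom i.
    by have /integrableP[/measurable_EFinP] := IU.
  - exact: (indep_seq_of_mutually_independent (measurable_linear u) X_indep).
  - by move=> i; have [] := mom i.
  - by move=> i; have [] := mom i.
  - by move=> i; have [] := mom i.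
  - move=> g i mg g1.
    apply: (Rintegral_identically_distributed
      (g := fun x => g (\sum_(j < d) u ord0 j * x ord0 j)) (M := 1)) => //.
    exact: (measurableT_comp mg (measurable_linear u)).
have [M fM] := f_bounded.
(* Boundedness of [f] makes the extended-real expectations finite, so the limit can be taken among
   real integrals. *)
have If d' (S : measurableType d') (p : probability S R) (Z : S -> 'rV[R]_d) :
    (forall j, measurable_fun setT (coordinate Z j)) ->
    ('E_p[fun w => f (Z w)])%E = (\int[p]_w f (Z w))%:E.
  move=> mZ; rewrite unlock fineK//; apply: integrable_fin_num => //.
  apply: (@integrable_bounded _ _ _ _ _ M) => //.
  exact: measurable_unif_continuous.
rewrite (If _ _ _ xi)//.
under eq_fun => n do rewrite (If _ _ P (Y n))//.
apply: cvg_EFin; first exact: nearW.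
exact: (cvg_Rintegral_of_cos mY mxi IY Ixi cosY f_bounded f_unif_continuous).
Qed.
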